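(* Let $f\in C^{0,\alpha}(\mathbb{T}^n)$ for some $0<\alpha\leq1$. Then, for each $x\in\mathbb{T}^n$, $$\lim_{\sigma\to0^+}(-\Delta)^{\sigma/2}f(x)=f(x)-\frac{1}{(2\pi)^n}\int_{\mathbb{T}^n}f(y)\,dy.$$
   Context: $\mathbb{T}^n$, $n\ge1$, is the torus $\mathbb{R}^n/2\pi\mathbb{Z}^n$. $C^{0,\alpha}(\mathbb{T}^n)$ is the space of real functions on $\mathbb{T}^n$ that are $\alpha$-Hölder continuous with respect to the geodesic distance. With $c_\nu(f)=\frac1{(2\pi)^n}\int_{\mathbb{T}^n}f(x)e^{-i\nu\cdot x}dx$, the fractional Laplacian of a smooth function is $(-\Delta)^{\sigma/2}f(x)=\sum_{\nu\in\mathbb{Z}^n}|\nu|^\sigma c_\nu(f)e^{i\nu\cdot x}$; for $f\in L^1(\mathbb{T}^n)$ it is the periodic distribution $\phi\mapsto\int_{\mathbb{T}^n}f(-\Delta)^{\sigma/2}\phi\,dx$, $\phi\in C^\infty(\mathbb{T}^n)$. For $f\in C^{0,\alpha}(\mathbb{T}^n)$ and $0<\sigma<\alpha$ this distribution is a continuous function, whose values (denoted $(-\Delta)^{\sigma/2}f(x)$) are given by $\frac1{\Gamma(-\sigma/2)}\int_0^\infty\big(e^{t\Delta}f(x)-f(x)\big)\frac{dt}{t^{1+\sigma/2}}$, where $e^{t\Delta}f(x)=\sum_{\nu\in\mathbb{Z}^n}e^{-t|\nu|^2}c_\nu(f)e^{i\nu\cdot x}$. *)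

(* Defs.v *)
From HB Require Import structures.
From mathcomp Require Import all_boot all_order all_algebra.
From mathcomp Require Import all_classical all_reals all_analysis.
From mathcomp.analysis.showcase Require Import summability.
From mathcomp Require Import complex.

Set Implicit Arguments.
Unset Strict Implicit.
Unset Printing Implicit Defensive.

Import Order.TTheory GRing.Theory Num.Theory.
Import numFieldNormedType.Exports.

Local Open Scope classical_set_scope.
Local Open Scope ring_scope.

(* Lebesgue measure on R^n, carried by n.-tuple R, which has the product
   sigma-algebra (the library puts no sigma-algebra on 'rV[R]_n). *)
Section lebesgue_tuple.
Context {R : realType}.

Local Notation tuples n := (n.-tuple (measurableTypeR R)).

Definition tcons n (p : measurableTypeR R * tuples n) : tuples n.+1 :=
  [tuple of p.1 :: p.2].

Lemma measurable_tcons n : measurable_fun setT (@tcons n).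
Proof. exact: (measurable_cons measurable_fst measurable_snd). Qed.

Section lebesgue_tcons.
Variables (n : nat).
Variable mu : {sigma_finite_measure set (tuples n) -> \bar R}.

Definition lebesgue_tcons : set (tuples n.+1) -> \bar R :=
  pushforward (@lebesgue_measure R \x mu)%E (@tcons n).

Let m0 : lebesgue_tcons set0 = 0%E.
Proof. by rewrite /lebesgue_tcons /pushforward preimage_set0 measure0. Qed.

Let mge0 A : (0 <= lebesgue_tcons A)%E.
Proof. by rewrite /lebesgue_tcons /pushforward measure_ge0. Qed.

Let msigma : semi_sigma_additive lebesgue_tcons.
Proof.
rewrite /lebesgue_tcons.
move=> F mF tF mUF; rewrite /pushforward preimage_bigcup.
apply: measure_semi_sigma_additive.
- by move=> k; rewrite -[X in measurable X]setTI; exact: measurable_tcons.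
- apply/trivIsetP => /= i j _ _ ij; rewrite -preimage_setI.
  by move/trivIsetP : tF => /(_ _ _ _ _ ij) ->//; rewrite preimage_set0.
- by rewrite -preimage_bigcup -[X in measurable X]setTI; exact: measurable_tcons.
Qed.

HB.instance Definition _ :=
  isMeasure.Build _ _ _ lebesgue_tcons m0 mge0 msigma.

Let msf : sigma_finite setT lebesgue_tcons.
Proof.
pose u (t : tuples n.+1) : measurableTypeR R * tuples n :=
  (thead t, [tuple of behead t]).
have mu_ : measurable_fun setT u.
  apply/measurable_fun_pairP; split.
  - exact: measurable_tnth.
  - exact: measurable_behead.
have uK p : u (tcons p) = p.
  case: p => a t; rewrite /u /tcons /= theadE; congr (_, _).
  by apply/val_inj.
have /sigma_finiteP[F [TF ndF Foo]] := sigma_finiteT (@lebesgue_measure R).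
have /sigma_finiteP[G [TG ndG Goo]] := sigma_finiteT mu.
exists (fun k => u @^-1` (F k `*` G k)).
  apply/seteqP; split=> // t _.
  have [i _ Fi] : (\bigcup_i F i) (u t).1 by rewrite -TF.
  have [j _ Gj] : (\bigcup_i G i) (u t).2 by rewrite -TG.
  exists (maxn i j) => //; split.
  - by move: Fi; exact/subsetPset/ndF/leq_maxl.
  - by move: Gj; exact/subsetPset/ndG/leq_maxr.
move=> k; have [mFk Fk] := Foo k; have [mGk Gk] := Goo k; split.
  by rewrite -[X in measurable X]setTI; apply: mu_ => //; exact: measurableX.
rewrite /lebesgue_tcons /pushforward -comp_preimage.
rewrite (_ : u \o _ = id); last by apply/funext => p /=; rewrite uK.
by rewrite preimage_id product_measure1E// lte_mul_pinfty// ge0_fin_numE.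
Qed.

HB.instance Definition _ :=
  Measure_isSigmaFinite.Build _ _ _ lebesgue_tcons msf.

End lebesgue_tcons.


Fixpoint lebesgue_tuple n : {sigma_finite_measure set (tuples n) -> \bar R} :=
  if n is n'.+1 then
    lebesgue_tcons (lebesgue_tuple n')
  else \d_([tuple] : tuples 0).

End lebesgue_tuple.

(* Points of R^n are row vectors; a function on the torus R^n / 2 pi Z^n is a
   function on R^n invariant under translation by 2 pi Z^n. *)
Section torus.
Context {R : realType} {n : nat}.
Implicit Types (f g phi : 'rV[R]_n -> R) (x y v : 'rV[R]_n).
Implicit Types (nu : 'rV[int]_n) (alpha sigma : R).

Definition intvec nu : 'rV[R]_n := map_mx intr nu.

Definition torus_fun f := forall x nu, f (x + (2 * pi) *: intvec nu) = f x.

Definition dotv x y : R := \sum_(i < n) x 0 i * y 0 i.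

Definition enorm x : R := Num.sqrt (dotv x x).

(* In the flat torus geodesics are projections of straight lines, so that the
   geodesic distance is the Euclidean distance between the two orbits. *)
Definition geodesic_dist x y : R :=
  inf [set enorm (x - y + (2 * pi) *: intvec nu) | nu in [set: 'rV[int]_n]].

Definition holder_torus alpha f :=
  torus_fun f /\
  exists C : R, forall x y, `|f x - f y| <= C * geodesic_dist x y `^ alpha.

Definition torus_integral f : R :=
  \int[lebesgue_tuple n]_(t in [set t | forall i, 0 <= tnth t i < 2 * pi])
    f (\row_i tnth t i).

Definition torus_mean f : R := ((2 * pi) ^+ n)^-1 * torus_integral f.

(* exp(i s) *)
Definition cis (s : R) : R[i] := (cos s +i* sin s)%C.

(* The integral of the complex function f(x) exp(-i nu.x) is taken on the real
   and imaginary parts. *)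
Definition fourier_coef f nu : R[i] :=
  (torus_mean (fun x => complex.Re ((f x)%:C%C * cis (- dotv (intvec nu) x))) +i*
   torus_mean (fun x => complex.Im ((f x)%:C%C * cis (- dotv (intvec nu) x))))%C.

Definition partial_derivative f (i : 'I_n) : 'rV[R]_n -> R :=
  fun x => 'D_('e_i) f x.

Definition smooth_torus f :=
  torus_fun f /\
  forall s : seq 'I_n,
    let g := foldl partial_derivative f s in
    continuous g /\ forall x i, derivable g x 'e_i.

(* For a real function the terms of indices nu and - nu are conjugate, so that
   the Fourier series of its fractional Laplacian is the (unconditional) sum of
   the real parts of its terms. *)
Definition fraclap_smooth sigma phi x : R :=
  summability.sum (fun nu : 'rV[int]_n =>
    complex.Re ((enorm (intvec nu) `^ sigma)%:C%C * fourier_coef phi nu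
                * cis (dotv (intvec nu) x)) : R^o).

(* The fractional Laplacian of an integrable function, a periodic distribution,
   as a functional on smooth functions. *)
Definition fraclap_distr sigma f phi : R :=
  torus_integral (fun x => f x * fraclap_smooth sigma phi x).

Definition distr_is_continuous_fun (T : ('rV[R]_n -> R) -> R) g :=
  [/\ torus_fun g, continuous g &
      forall phi, smooth_torus phi ->
        T phi = torus_integral (fun x => g x * phi x)].

(* The continuous function which the distribution is; continuous functions
   that agree as distributions are equal, so the choice made by [get] is only
   between equal functions. *)
Definition fraclap sigma f : 'rV[R]_n -> R :=
  get (distr_is_continuous_fun (fraclap_distr sigma f)).

End torus.

(* Main.v *)
(** The operator $(-\Delta)^{\sigma/2}$ is bounded, uniformly for
    $0 < \sigma \le \alpha/4$, from trigonometric polynomials with the Hoelder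
    norm of exponent $\alpha/2$ to trigonometric polynomials with the uniform
    norm.  Instead of the heat semigroup the bound uses the simple random walk of
    step $h = K^{-1/2}$: if $q_h(\nu) = n^{-1} \sum_j \cos(h \nu_j)$ is the
    multiplier of the averaging operator $A_h$, then
    $2nK(1 - q_h(\nu)) \to |\nu|^2$, and the binomial series writes
    $(1 - q)^{\sigma/2} = \sum_k b_k (q^k - q^{k+1})$ with
    $b_k = \prod_{j \le k} (1 - \sigma/(2j))$.  By Abel summation this is an average
    of the differences $P - A_h^k P$, which are controlled by the variance $k h^2$
    of the walk.

    The Fejer means of $f$ have the same Hoelder constant as $f$ and converge
    uniformly, so they converge in every smaller Hoelder norm; their fractional
    Laplacians therefore converge uniformly, the limit represents the
    distribution $(-\Delta)^{\sigma/2} f$ by duality, and the convergence is uniform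
    in $\sigma$.  This reduces the limit $\sigma \to 0$ to trigonometric polynomials,
    where $|\nu|^\sigma \to 1$ for $\nu \ne 0$ and $|0|^\sigma = 0$. *)
Require Import Defs.
From mathcomp Require Import all_boot all_order all_algebra finmap.
From mathcomp Require Import all_classical all_reals all_analysis.
From mathcomp.analysis.showcase Require Import summability.
From mathcomp Require Import measurable_realfun complex ring lra.
Import Order.TTheory GRing.Theory Num.Theory.
Import numFieldNormedType.Exports.
Local Open Scope classical_set_scope.
Local Open Scope ring_scope.

Set Implicit Arguments.
Unset Strict Implicit.
Unset Printing Implicit Defensive.

(** * Integration over the box *)

(** The obstacle is the exchange of two limits, sigma to 0 and the Fejer degree to infinity, so the
    constants must be free of sigma. The operator is unbounded in the uniform norm, and the Fejer
    means of a Hoelder function need not converge in its own Hoelder norm; giving up half of the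
    exponent turns uniform convergence into convergence in a Hoelder norm to which the bound
    applies. Moduli of continuity are written with squared distances, so the Hoelder exponent alpha
    / 2 appears as g = alpha / 4. With s = sigma / 2, the condition 2 s <= g under which the
    binomial sums are controlled reads sigma <= alpha / 4. The walk keeps everything within finite
    sums and finite differences; its variance enters as a comparison with paraboloids. Since
    [fraclap] is a choice made by [get], both existence and uniqueness of the continuous
    representative have to be proved. Explicit integrals over the box are computed for cosine waves
    only; invariance of the mean under reflections and translations is deduced from them by uniform
    approximation. *)

Section box_integrals.
Context {R : realType}.
Local Notation tuples n := (n.-tuple (measurableTypeR R)).

Definition box n : set (tuples n) :=
  [set t | forall i, 0 <= tnth t i < 2 * pi].

(** An open set is the union of the cubes with rational centre and radius 1/(k+1) that it contains.
    This family is countable, and each cube is a finite intersection of measurable conditions on the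
    coordinates. *)
Lemma row_preimage_measurable n (U : set 'rV[R]_n) : open U ->
  measurable [set t : tuples n | U (\row_i tnth t i)].
Proof.
move=> oU.
pose B (p : 'rV[rat]_n * nat) : set 'rV[R]_n :=
  [set x | forall i, `|x 0 i - ratr (p.1 0 i)| < p.2.+1%:R^-1].
pose A (p : 'rV[rat]_n * nat) : set (tuples n) :=
  [set t | B p `<=` U /\ B p (\row_i tnth t i)].
have -> : [set t : tuples n | U (\row_i tnth t i)] = \bigcup_p A p.
  apply/seteqP; split=> [t /= Ut|t [p _] [BU Bt]]; last exact: BU.
  have /nbhs_ballP[e /= e0 eU] : nbhs (\row_i tnth t i) U by exact: open_nbhs_nbhs.
  have [k ke] : exists k : nat, k.+1%:R^-1 < e / 2.
    exists (Num.trunc (e / 2)^-1); rewrite invf_plt ?posrE//; last by rewrite divr_gt0.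
    by rewrite truncnS_gt.
  have ex i : exists q : rat, ratr q \in `](tnth t i - k.+1%:R^-1 : R), tnth t i[.
    by apply: rat_in_itvoo; rewrite ltrBlDr ltrDl invr_gt0.
  pose q := \row_i projT1 (cid (ex i)).
  have qP i : `|tnth t i - ratr (q 0 i)| < k.+1%:R^-1.
    rewrite /q mxE; case: (cid _) => r /=; rewrite in_itv/= => /andP[h1 h2].
    by rewrite ger0_norm; [rewrite ltrBlDr -ltrBlDl|rewrite subr_ge0 ltW].
  exists (q, k) => //; split=> /=; last by move=> i; rewrite mxE.
  move=> x /= Bx; apply: eU; split=> // i j; rewrite ord1 mxE/= /ball/=.
  rewrite [e]splitr (le_lt_trans (ler_distD (ratr (q 0 j)) _ _))// ltrD//.
    by rewrite (lt_trans (qP j)).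
  by rewrite distrC (lt_trans (Bx j)).
apply: countable_bigcupT_measurable; first exact: countableP.
move=> p; rewrite /A; have [BU|nBU] := pselect (B p `<=` U); last first.
  by rewrite (_ : mkset _ = set0)//; apply/seteqP; split=> // t [].
rewrite (_ : mkset _ = \bigcap_(i in [set: 'I_n])
    [set t : tuples n | `|tnth t i - ratr (p.1 0 i)| < p.2.+1%:R^-1]); last first.
  apply/seteqP; split=> [t [_ Bt] i _|t Bt]; first by have := Bt i; rewrite mxE.
  by split=> // i; rewrite mxE; exact: Bt.
apply: fin_bigcap_measurable; first exact: finite_finset.
move=> i _.
have mf : measurable_fun setT
    (fun t : tuples n => `|tnth t i - ratr (p.1 0 i)| : R).
  apply: measurableT_comp => //; apply: measurable_funB => //.
  exact: measurable_tnth.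
rewrite -[X in measurable X]setTI.
rewrite (_ : mkset _ = (fun t : tuples n => `|tnth t i - ratr (p.1 0 i)| : R)
  @^-1` `]-oo, p.2.+1%:R^-1[%classic); first exact: mf.
by apply/seteqP; split=> t /=; rewrite in_itv/=.
Qed.

Lemma measurable_row n (f : 'rV[R]_n -> R) : continuous f ->
  measurable_fun setT (fun t : tuples n => f (\row_i tnth t i)).
Proof.
move=> cf; apply: (measurability _ (RGenOInfty.measurableE R)) => //.
move=> _ [_ [y ->] <-]; rewrite setTI.
apply: (@row_preimage_measurable n (f @^-1` `]y, +oo[)).
by move/continuousP: cf; apply; exact: interval_open.
Qed.

Lemma measurable_box n : measurable (@box n).
Proof.
rewrite (_ : @box n = \bigcap_(i in [set: 'I_n])
    ((fun t : tuples n => tnth t i) @^-1` `[0, 2 * pi[%classic)); last first.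
  apply/seteqP; split=> [t bt i _|t bt i]/=; first by rewrite in_itv/=; exact: bt.
  by have := bt i I; rewrite /= in_itv.
apply: fin_bigcap_measurable; first exact: finite_finset.
by move=> i _; rewrite -[X in measurable X]setTI; exact: measurable_tnth.
Qed.

Lemma tcons_box n (a : R) (t : tuples n) :
  box (tcons (a, t)) <-> 0 <= a < 2 * pi /\ box t.
Proof.
split=> [bt|[a0 bt] i].
  split; first by have := bt ord0; rewrite (tnth_nth 0).
  by move=> i; have := bt (lift ord0 i); rewrite !(tnth_nth 0)/=.
rewrite (tnth_nth 0) /=; case: (unliftP ord0 i) => [j ->|->] //=.
by have := bt j; rewrite (tnth_nth 0).
Qed.

Lemma preimage_tcons_box n :
  @tcons R n @^-1` @box n.+1 = `[0, 2 * pi[%classic `*` @box n.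
Proof.
apply/seteqP; split=> -[a t] /=.
  by move/tcons_box => -[]; rewrite in_itv.
by rewrite in_itv/= => h; apply/tcons_box.
Qed.

Lemma lebesgue_box n : lebesgue_tuple n (@box n) = ((2 * pi) ^+ n)%:E :> \bar R.
Proof.
elim: n => [|n IH].
  rewrite /= diracE mem_set ?expr0//.
  by case.
rewrite [LHS](_ : _ = pushforward (@lebesgue_measure R \x lebesgue_tuple n)%E
  (@tcons R n) (@box n.+1))//.
rewrite /pushforward preimage_tcons_box product_measure1E//; last exact: measurable_box.
have mI : lebesgue_measure (`[0, 2 * pi[%classic : set (measurableTypeR R)) =
    (2 * pi)%:E :> \bar R.
  rewrite (lebesgue_measure_itv `[0, 2 * pi[%R)/= lte_fin.
  by rewrite mulr_gt0 ?pi_gt0// oppr0 adde0.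
transitivity ((2 * pi)%:E * ((2 * pi) ^+ n)%:E : \bar R)%E; last first.
  by rewrite -EFinM exprS.
by congr (_ * _)%E.
Qed.

Lemma integrable_box n (f : tuples n -> R) M :
  measurable_fun setT f -> (forall t, `|f t| <= M) ->
  (lebesgue_tuple n).-integrable (@box n) (EFin \o f).
Proof.
move=> mf fM; apply: measurable_bounded_integrable.
- exact: measurable_box.
- apply: (@le_lt_trans _ _ ((2 * pi) ^+ n)%:E); last exact: ltry.
  by rewrite le_eqVlt; apply/orP; left; exact/eqP/lebesgue_box.
- exact: measurable_funTS.
- exists M; split; first exact: num_real.
  by move=> N MN t _ /=; rewrite (le_trans (fM t))// ltW.
Qed.

(** Fubini for the pushforward that defines [lebesgue_tuple]. It isolates the first coordinate and
    gives the induction step of [Rintegral_box_wave]. *)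
Lemma Rintegral_box_tcons n (f : tuples n.+1 -> R) M :
  measurable_fun setT f -> (forall t, `|f t| <= M) ->
  (\int[lebesgue_tuple n.+1]_(t in @box n.+1) f t =
   \int[lebesgue_measure]_(a in `[0%R, 2 * pi[)
     \int[lebesgue_tuple n]_(t in @box n) f (tcons (a, t)))%R.
Proof.
move=> mf fM.
have mb := @measurable_box n.
have mcons := @measurable_tcons R n.
have mb1 := @measurable_box n.+1.
have mfr : measurable_fun setT ((EFin \o f) \_ (@box n.+1)).
  by apply/(measurable_restrictT _ mb1)/measurable_funTS/measurable_EFinP.
(* True by unfolding; it displays the measure as a pushforward, so that a change of variables
   applies. *)
have pushE D (g : tuples n.+1 -> \bar R) :
    (\int[lebesgue_tuple n.+1]_(t in D) g t =
     \int[pushforward (@lebesgue_measure R \x lebesgue_tuple n)%E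
       (@tcons R n)]_(t in D) g t)%E by [].
have intp : (@lebesgue_measure R \x lebesgue_tuple n)%E.-integrable setT
    (((EFin \o f) \_ (@box n.+1)) \o @tcons R n).
  apply/integrableP; split; first exact: measurableT_comp.
  have := integrable_box mf fM => /integrableP[_].
  have absE : (fun t => `|(EFin \o f) t|)%E \_ (@box n.+1) =
    (fun t => `|((EFin \o f) \_ (@box n.+1)) t|)%E := restrict_abse _ _.
  rewrite integral_mkcond absE pushE ge0_integral_pushforward//.
  exact: measurableT_comp.
rewrite /Rintegral; congr fine.
rewrite integral_mkcond pushE integral_pushforward// ?preimage_setT//.
rewrite -integral12_prod_meas1// [RHS]integral_mkcond.
apply: eq_integral => a _; rewrite /fubini_F /= /patch.
case: ifPn => [|]; rewrite ?inE => ha.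
  rewrite -/(Rintegral _ _ _).
  rewrite /Rintegral fineK; last first.
    apply: integrable_fin_num; first by [].
    apply: (@integrable_box n (fun t => f (tcons (a, t))) M) => //.
    apply: measurableT_comp => //; apply: measurableT_comp => //.
  rewrite [RHS]integral_mkcond; apply: eq_integral => t _; rewrite /patch.
  have -> // : (tcons (a, t) \in @box n.+1) = (t \in @box n).
  apply/idP/idP; rewrite !inE => h; first by case/tcons_box: h.
  by apply/tcons_box; split=> //; move: ha; rewrite /= in_itv.
apply: integral0_eq => t _; rewrite ifF//; apply/negbTE; rewrite notin_setE.
move=> /tcons_box[a02 _]; move: ha; rewrite notin_setE /= in_itv/=; apply.
exact: a02.
Qed.

End box_integrals.

(** * Periodic functions and trigonometric waves *)

Lemma cvg_sumr {R : realType} (T : Type) (F : set_system T) (I : Type)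
    (r : seq I) (P : pred I) (u : I -> T -> R) (l : I -> R) :
  Filter F -> (forall i, P i -> u i x @[x --> F] --> l i) ->
  \sum_(i <- r | P i) u i x @[x --> F] --> \sum_(i <- r | P i) l i.
Proof.
move=> FF ul; elim: r => [|i r IH].
  under eq_cvg do rewrite big_nil.
  by rewrite big_nil; exact: cvg_cst.
under eq_cvg do rewrite big_cons.
rewrite big_cons; case: ifPn => // Pi.
by apply: cvgD; [exact: ul|exact: IH].
Qed.

Section trig_waves.
Context {R : realType}.

Lemma cosD2pin (x : R) (m : int) : cos (x + 2 * pi * m%:~R) = cos x.
Proof.
have P k y : cos (y + 2 * pi * k%:R) = cos y :> R.
  have -> : 2 * pi * k%:R = pi *+ 2 *+ k :> R by rewrite mulr_natr mulr_natl.
  exact: (periodicn (@cosD2pi R)).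

case: m => k; first exact: P.
rewrite NegzE mulrNz mulrN -(P k.+1 (x - _)).
by rewrite subrK.
Qed.

(** 1 - cos x is 2 sin^2 (x/2), and the sine has no zero strictly between 0 and pi. The range
    allowed for x is that of differences of two points of [0, 2 pi]. *)
Lemma cos_eq1 (x : R) : `|x| <= 2 * pi -> cos x = 1 ->
  exists m : int, x = 2 * pi * m%:~R.
Proof.
move=> x2pi cx; have pi0 := @pi_gt0 R.
have s0 : sin (x / 2) = 0.
  apply/eqP; rewrite -sqrf_eq0 sin2cos2.
  have := cos_mulr2n (x / 2); rewrite -(mulr_natr (x / 2)) divfK// cx => h.
  by apply/eqP; move: h; rewrite mulr2n; lra.
have [->|x0] := eqVneq x 0; first by exists 0; rewrite mulr0z mulr0.
have [x2|x2] := ltP `|x| (2 * pi).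
  have : 0 < sin (`|x| / 2).
    by apply: sin_gt0_pi; rewrite divr_gt0 ?normr_gt0//=; lra.
  have [x00|x00] := ger0P x; first by rewrite s0 ltxx.
  by rewrite mulNr sinN s0 oppr0 ltxx.
have {x2 x2pi} : `|x| = 2 * pi by apply/eqP; rewrite eq_le x2pi.
have [x00 ->|x00 E] := ger0P x; first by exists 1; rewrite mulr1.
by exists (-1); rewrite mulrNz mulrN mulr1 -E opprK.
Qed.

Context {n : nat}.
Implicit Types (f g : 'rV[R]_n -> R) (x y v : 'rV[R]_n) (nu : 'rV[int]_n).

Lemma dotvDr x y v : dotv x (y + v) = dotv x y + dotv x v.
Proof. by rewrite -big_split; apply: eq_bigr => i _; rewrite mxE mulrDr. Qed.

Lemma dotvZr x a y : dotv x (a *: y) = a * dotv x y.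
Proof. by rewrite mulr_sumr; apply: eq_bigr => i _; rewrite mxE mulrCA. Qed.

Lemma dotvNr x y : dotv x (- y) = - dotv x y.
Proof. by rewrite -scaleN1r dotvZr mulN1r. Qed.

Lemma dotvC x y : dotv x y = dotv y x.
Proof. by apply: eq_bigr => i _; rewrite mulrC. Qed.

Lemma dotvDl x y v : dotv (x + y) v = dotv x v + dotv y v.
Proof. by rewrite dotvC dotvDr !(dotvC v). Qed.

Lemma dotvNl x y : dotv (- x) y = - dotv x y.
Proof. by rewrite dotvC dotvNr dotvC. Qed.

Lemma dotv0l x : dotv 0 x = 0.
Proof. by rewrite /dotv big1// => i _; rewrite mxE mul0r. Qed.

Lemma dotv_delta x i : dotv x 'e_i = x 0 i.
Proof.
rewrite /dotv (bigD1 i)//= mxE !eqxx mulr1 big1 ?addr0// => j ji.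
by rewrite mxE (negbTE ji) andbF mulr0.
Qed.

Lemma intvecD nu nu' : intvec (nu + nu') = intvec nu + intvec nu' :> 'rV[R]_n.
Proof. exact: map_mxD. Qed.

Lemma intvecN nu : intvec (- nu) = - intvec nu :> 'rV[R]_n.
Proof. exact: map_mxN. Qed.

Lemma intvec0 : intvec 0 = 0 :> 'rV[R]_n.
Proof. exact: map_mx0. Qed.

Lemma continuous_dotv x : continuous (dotv x).
Proof.
move=> y; rewrite /dotv; apply: (@cvg_sumr _ _ (nbhs y)) => i _.
by apply: (@cvgM _ _ (nbhs y) _ (fun=> x 0 i)); [exact: cvg_cst|exact: coord_continuous].
Qed.

(** The free phase lets one real family contain cosines and sines (phase - pi/2), be stable under
    translation and differentiation (phase + pi/2), and absorb a coordinate that is held fixed. *)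
Definition wave nu (c : R) : 'rV[R]_n -> R := fun x => cos (dotv (intvec nu) x + c).

Lemma continuous_wave nu c : continuous (wave nu c).
Proof.
move=> x; apply: (@continuous_comp _ _ _ (fun x => dotv (intvec nu) x + c) (@cos R)).
  apply: (@cvgD _ _ _ (nbhs x)); last exact: cvg_cst.
  exact: (@continuous_dotv (intvec nu) x).
exact: continuous_cos.
Qed.

Lemma torus_wave nu c : torus_fun (wave nu c).
Proof.
move=> x mu; rewrite /wave dotvDr dotvZr addrAC.
have -> : dotv (intvec nu) (intvec mu) =
    (\sum_(i < n) nu 0 i * mu 0 i)%:~R :> R.
  by rewrite rmorph_sum; apply: eq_bigr => i _; rewrite !mxE rmorphM.
exact: cosD2pin.
Qed.

Lemma wave_le1 nu c x : `|wave nu c x| <= 1.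
Proof. exact: cos_max. Qed.

Lemma torus_reduce x : exists nu, forall i,
  (x + (2 * pi) *: intvec nu) 0 i \in `[0, 2 * pi].
Proof.
exists (\row_i (- Num.floor (x 0 i / (2 * pi)))) => i.
have pi0 : (0 : R) < 2 * pi by rewrite mulr_gt0// pi_gt0.
rewrite !mxE in_itv/= mulrNz mulrN subr_ge0.
have /andP[h1 h2] := floor_itv (x 0 i / (2 * pi)).
rewrite -ler_pdivlMl// [X in _ <= X]mulrC h1/=.
move: h2; rewrite ltr_pdivrMr// intrD mulrDl mul1r => h2.
by rewrite lerBlDr ltW// addrC mulrC.
Qed.

(* Compactness: off the diagonal of the torus the sum on the right is bounded
   below, and on the diagonal the left-hand side vanishes. *)
Lemma torus_modulus f e : torus_fun f -> continuous f -> 0 < e ->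
  exists2 C, 0 <= C & forall x y,
    `|f x - f y| <= e + C * \sum_(i < n) (1 - cos (x 0 i - y 0 i)).
Proof.
move=> tf cf e0.
pose K := [set v : 'rV[R]_n | forall i, v ord0 i \in `[0, 2 * pi]].
have cK : compact K.
  by apply: (@rV_compact _ _ (fun=> `[0, 2 * pi]%classic)) => i; exact: segment_compact.
pose S (p : 'rV[R]_n * 'rV[R]_n) : R := \sum_(i < n) (1 - cos (p.1 0 i - p.2 0 i)).
have S0 p : 0 <= S p by apply: sumr_ge0 => i _; rewrite subr_ge0 cos_le1.
have cS : continuous S.
  move=> p; apply: (@cvg_sumr _ _ (nbhs p)) => i _; apply: cvgB; first exact: cvg_cst.
  apply: (@continuous_comp _ _ _ (fun p : 'rV[R]_n * 'rV[R]_n => p.1 0 i - p.2 0 i)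
    (@cos R)); last exact: continuous_cos.
  apply: cvgB.
    apply: (@continuous_comp _ _ _ fst (fun x : 'rV[R]_n => x 0 i)).
      exact: cvg_fst.
    exact: coord_continuous.
  apply: (@continuous_comp _ _ _ snd (fun x : 'rV[R]_n => x 0 i)).
    exact: cvg_snd.
  exact: coord_continuous.
pose D (p : 'rV[R]_n * 'rV[R]_n) : R := `|f p.1 - f p.2|.
have cD : continuous D.
  move=> p; apply: cvg_norm; apply: cvgB.
    by apply: (@continuous_comp _ _ _ fst f); [exact: cvg_fst|exact: cf].
  by apply: (@continuous_comp _ _ _ snd f); [exact: cvg_snd|exact: cf].
have [C [C0 HC]] : exists C, 0 <= C /\ forall p, (K `*` K) p -> D p <= e + C * S p.
  (* Compactness in near-covering form: it suffices to find, around each point, a neighbourhood on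
     which the bound holds for all large C. *)
  have /compact_near_coveringP := compact_setX cK cK.
  move=> /(_ R +oo%R (fun C p => D p <= e + C * S p) _) H.
  have {}H : \forall C \near +oo, K `*` K `<=` [set p | D p <= e + C * S p].
    apply: H => -[x y] [/= Kx Ky].
    have [Sp|Sp] := ltP 0 (S (x, y)).
      (* Near a point where S is positive, S stays above half its value and D below its value plus
         1; this tells how large C has to be. *)
      exists ([set p | S (x, y) / 2 < S p /\ D p < D (x, y) + 1],
              [set C : R | 0 <= C /\ (D (x, y) + 1) / (S (x, y) / 2) <= C]).
        split => /=.
          near=> p; split; near: p.
            by apply: (cvgr_gt _ (cS (x, y))); rewrite ltr_pdivrMr// ltr_pMr// ltr1n.
          by apply: (cvgr_lt _ (cD (x, y))); rewrite ltrDl.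
        near=> C; split; near: C; apply: nbhs_pinfty_ge; exact: num_real.
      move=> [p C]/= [[h1 h2] [C0 h3]]; rewrite (le_trans (ltW h2))//.
      apply: (@le_trans _ _ (C * S p)); last by rewrite lerDr ltW.
      move: h3; rewrite ler_pdivrMr ?divr_gt0// => h3; apply: (le_trans h3).
      by rewrite ler_wpM2l// ltW.
    have {}Sp : S (x, y) = 0 by apply/eqP; rewrite eq_le Sp sumr_ge0// => i _;
      rewrite subr_ge0 cos_le1.
    have Dp : D (x, y) = 0.
      have H1 i : exists m : int, x 0 i - y 0 i = 2 * pi * m%:~R.
        apply: cos_eq1.
          have := Kx i; have := Ky i; rewrite !in_itv/= ler_norml => /andP[a1 a2] /andP[b1 b2].
          by apply/andP; split; lra.
        apply/esym/eqP; rewrite -subr_eq0; move/eqP: Sp; rewrite psumr_eq0.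
          by move=> /allP/(_ i); rewrite mem_index_enum => /(_ isT).
        by move=> j _; rewrite subr_ge0 cos_le1.
      pose nu := \row_i projT1 (cid (H1 i)).
      rewrite /D/= (_ : x = y + (2 * pi) *: intvec nu) ?tf ?subrr ?normr0//.
      apply/rowP => i; rewrite !mxE; case: (cid _) => m /= <-.
      by rewrite addrC subrK.
    exists ([set p | D p < e], [set C : R | 0 <= C]).
      split => /=; last by apply: nbhs_pinfty_ge; exact: num_real.
      by apply: (cvgr_lt _ (cD (x, y))); rewrite Dp.
    by move=> [p C]/= [h1 h2]; rewrite (le_trans (ltW h1))// lerDl mulr_ge0.
  have : \forall C \near +oo, 0 <= C /\ forall p, (K `*` K) p -> D p <= e + C * S p.
    by near=> C; split; near: C; [by apply: nbhs_pinfty_ge; exact: num_real|exact: H].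
  by move=> /filter_ex[C [C0 HC]]; exists C.
exists C => // x y.
have [nu Hnu] := torus_reduce x; have [mu Hmu] := torus_reduce y.
rewrite -(tf x nu) -(tf y mu).
have := HC (x + (2 * pi) *: intvec nu, y + (2 * pi) *: intvec mu) (conj Hnu Hmu).
rewrite /D /S /= => /le_trans; apply.
rewrite lerD2l ler_wpM2l//; apply: ler_sum => i _; rewrite !mxE.
rewrite -(cosD2pin (x 0 i - y 0 i) (nu 0 i - mu 0 i)) lerB//.
by rewrite le_eqVlt; apply/orP; left; apply/eqP; congr cos; rewrite intrB; ring.
Unshelve. all: by end_near. Qed.

Lemma torus_bounded f : torus_fun f -> continuous f ->
  exists2 M, 0 <= M & forall x, `|f x| <= M.
Proof.
move=> tf cf; have [C C0 HC] := torus_modulus tf cf (ltr01 : 0 < 1 :> R).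
exists (`|f 0| + (1 + C * \sum_(i < n) 2)) => [|x].
  by rewrite !addr_ge0// mulr_ge0// sumr_ge0.
rewrite -[f x](subrK (f 0)) addrC (le_trans (ler_normD _ _))// lerD2l.
rewrite (le_trans (HC _ _))// lerD2l ler_wpM2l// ler_sum// => i _.
by have := cos_geN1 (x 0 i - (0 : 'rV_n) 0 i); lra.
Qed.

End trig_waves.

(** * Integrals of waves over the box *)

Section integral_of_waves.
Context {R : realType}.

Lemma continuous_cos_affine (m c : R) : continuous (fun a => cos (m * a + c)).
Proof.
move=> a; apply: (@continuous_comp _ _ _ (fun a => m * a + c) (@cos R)).
  by apply: cvgD; [apply: cvgM; [exact: cvg_cst|exact: cvg_id]|exact: cvg_cst].
exact: continuous_cos.
Qed.

Lemma Rintegral_cos_affine (m : int) (c : R) :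
  \int[lebesgue_measure]_(a in `[0%R, 2 * pi[) cos (m%:~R * a + c) =
  (m == 0)%:R * (2 * pi * cos c).
Proof.
have pi0 : (0 : R) < 2 * pi by rewrite mulr_gt0// pi_gt0.
have [->|m0] := eqVneq m 0; rewrite ?(mul1r, mul0r).
  under eq_Rintegral do rewrite mul0r add0r.
  rewrite Rintegral_cst//= lebesgue_measure_itv/= lte_fin pi0 oppr0 adde0/=.
  by rewrite mulrC.
have mR0 : m%:~R != 0 :> R by rewrite intr_eq0.
have ci : lebesgue_measure.-integrable `[0, 2 * pi]
    (EFin \o (fun a => cos (m%:~R * a + c))).
  apply: continuous_compact_integrable; first exact: segment_compact.
  exact/continuous_subspaceT/continuous_cos_affine.
rewrite Rintegral_itv_bndo_bndc; last first.
  by apply: integrableS ci => //; exact: subset_itv_co_cc.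
pose F (a : R) := sin (m%:~R * a + c) / m%:~R.
have dF (a : R) : is_derive a (1 : R) F (cos (m%:~R * a + c)).
  rewrite /F; apply: is_derive_eq.
  rewrite !scaler0 !addr0 ?add0r /GRing.scale/= !mulr1 ?mulr0 ?addr0 ?add0r.
  by rewrite mulrC -mulrA mulfV ?mulr1.
have cF : continuous F.
  move=> a; apply/differentiable_continuous/derivable1_diffP.
  by have [] := dF a.
rewrite /Rintegral (@continuous_FTC2 _ _ F)//.
- rewrite /F mulr0 add0r /=.
  have -> : sin (m%:~R * (2 * pi) + c) = sin c.
    by rewrite addrC -!cosBpihalf addrAC [_%:~R * _]mulrC cosD2pin.
  by rewrite subrr.
- exact/continuous_subspaceT/continuous_cos_affine.
- split.
  + by move=> a _; have [] := dF a.
  + by apply: cvg_at_right_filter; exact: cF.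
  + by apply: cvg_at_left_filter; exact: cF.
- by move=> a _; rewrite derive1E; apply: derive_val.
Qed.

(** Induction on the dimension: with the first coordinate a fixed, the wave is a wave in the others
    whose phase has grown by nu_0 a, so the phase must be general in the induction hypothesis. *)
Lemma Rintegral_box_wave n (nu : 'rV[int]_n) (c : R) :
  \int[lebesgue_tuple n]_(t in @box R n) wave nu c (\row_i tnth t i) =
  (2 * pi) ^+ n * ((nu == 0)%:R * cos c).
Proof.
elim: n => [|n IH] in nu c *.
  have mb := @measurable_box R 0.
  have mw := measurable_row (@continuous_wave R 0 nu c).
  rewrite /Rintegral/= integral_dirac//=; last first.
    by apply/measurable_EFinP/measurable_funTS.
  rewrite expr0 indicE mem_set; last by case.
  by rewrite !mul1r /wave /dotv big_ord0 add0r (thinmx0 nu) eqxx mul1r.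
have mw := measurable_row (@continuous_wave R n.+1 nu c).
rewrite (Rintegral_box_tcons mw (M := 1)); last by move=> t; exact: wave_le1.
pose nu' : 'rV[int]_n := \row_i nu 0 (lift ord0 i).
have E a (t : n.-tuple (measurableTypeR R)) :
    wave nu c (\row_i tnth (tcons (a, t)) i) =
    wave nu' ((nu 0 0)%:~R * a + c) (\row_i tnth t i).
  rewrite /wave; congr cos; rewrite addrA; congr (_ + _).
  rewrite /dotv big_ord_recl addrC !mxE; congr (_ + _).
  by apply: eq_bigr => i _; rewrite !mxE !(tnth_nth 0).
under eq_Rintegral => a _ do (under eq_Rintegral do rewrite E; rewrite IH mulrA).
rewrite RintegralZl//; last first.
  have ci : lebesgue_measure.-integrable `[0, 2 * pi]
      (EFin \o (fun a : R => cos ((nu 0 0)%:~R * a + c))).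
    apply: continuous_compact_integrable; first exact: segment_compact.
    exact/continuous_subspaceT/continuous_cos_affine.
  by apply: integrableS ci => //; exact: subset_itv_co_cc.
rewrite Rintegral_cos_affine exprS.
have -> : (nu == 0) = (nu 0 0 == 0) && (nu' == 0).
  apply/eqP/andP => [nu0|[/eqP n0 /eqP n'0]].
    by split; apply/eqP; [rewrite nu0 mxE|apply/rowP => i; rewrite !mxE nu0 mxE].
  apply/rowP => i; rewrite mxE; case: (unliftP ord0 i) => [j ->|->]//.
  by move/rowP/(_ j): n'0; rewrite !mxE.
by rewrite -mulnb natrM; ring.
Qed.

End integral_of_waves.

(** * The mean of a continuous periodic function *)

Section torus_mean_theory.
Context {R : realType} {n : nat}.
Implicit Types (f g : 'rV[R]_n -> R) (x y v : 'rV[R]_n) (nu : 'rV[int]_n).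

Definition ctorus f := torus_fun f /\ continuous f.

Lemma ctorus_cst (a : R) : ctorus (fun=> a).
Proof. by split=> [x nu //|]; exact: cst_continuous. Qed.

Lemma ctorusD f g : ctorus f -> ctorus g -> ctorus (fun x => f x + g x).
Proof.
move=> [tf cf] [tg cg]; split=> [x nu|x]; first by rewrite tf tg.
by apply: (@cvgD _ _ _ (nbhs x)); [exact: cf|exact: cg].
Qed.

Lemma ctorusM f g : ctorus f -> ctorus g -> ctorus (fun x => f x * g x).
Proof.
move=> [tf cf] [tg cg]; split=> [x nu|x]; first by rewrite tf tg.
by apply: (@cvgM _ _ (nbhs x)); [exact: cf|exact: cg].
Qed.

Lemma ctorusZ (a : R) f : ctorus f -> ctorus (fun x => a * f x).
Proof. by apply: ctorusM; exact: ctorus_cst. Qed.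

Lemma ctorusN f : ctorus f -> ctorus (fun x => - f x).
Proof.
by move=> /(ctorusZ (-1)); under [X in ctorus X -> _]funext do rewrite mulN1r.
Qed.

Lemma ctorusB f g : ctorus f -> ctorus g -> ctorus (fun x => f x - g x).
Proof. by move=> cf cg; apply: ctorusD => //; exact: ctorusN. Qed.

Lemma ctorus_sum (I : Type) (r : seq I) (P : pred I) (f : I -> 'rV[R]_n -> R) :
  (forall i, P i -> ctorus (f i)) -> ctorus (fun x => \sum_(i <- r | P i) f i x).
Proof.
move=> cf; split=> [x nu|x].
  by apply: eq_bigr => i /cf[-> ].
by apply: (@cvg_sumr _ _ (nbhs x)) => i /cf[_]; exact.
Qed.

Lemma ctorus_wave nu c : ctorus (@wave R n nu c).
Proof. by split; [exact: torus_wave|exact: continuous_wave]. Qed.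

Lemma ctorus_norm f : ctorus f -> ctorus (fun x => `|f x|).
Proof.
move=> [tf cf]; split=> [x nu|x]; first by rewrite tf.
by apply: (@cvg_norm _ _ _ (nbhs x)); exact: cf.
Qed.

Lemma ctorus_shift v f : ctorus f -> ctorus (fun x => f (x + v)).
Proof.
move=> [tf cf]; split=> [x nu|x]; first by rewrite addrAC tf.
apply: (@continuous_comp _ _ _ (fun x => x + v) f); last exact: cf.
by apply: (@cvgD _ _ _ (nbhs x)); [exact: cvg_id|exact: cvg_cst].
Qed.

Lemma ctorus_refl v f : ctorus f -> ctorus (fun x => f (v - x)).
Proof.
move=> [tf cf]; split=> [x nu|x].
  by rewrite opprD addrA -scalerN -intvecN tf.
apply: (@continuous_comp _ _ _ (fun x => v - x) f); last exact: cf.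
by apply: (@cvgB _ _ _ (nbhs x)); [exact: cvg_cst|exact: cvg_id].
Qed.

Lemma ctorus_bounded f : ctorus f -> exists2 M, 0 <= M & forall x, `|f x| <= M.
Proof. by move=> [tf cf]; exact: torus_bounded. Qed.

Lemma ctorus_integrable f : ctorus f ->
  (lebesgue_tuple n).-integrable (@box R n) (EFin \o (fun t => f (\row_i tnth t i))).
Proof.
move=> cf; have [M M0 fM] := ctorus_bounded cf.
by apply: (@integrable_box R n _ M) => //; apply: measurable_row; case: cf.
Qed.

Lemma eq_torus_mean f g : f =1 g -> torus_mean f = torus_mean g.
Proof. by move=> fg; congr torus_mean; exact/funext. Qed.

Let pin : (0 : R) < (2 * pi) ^+ n.
Proof. by rewrite exprn_gt0// mulr_gt0// pi_gt0. Qed.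

Lemma torus_integral_mean f : torus_integral f = (2 * pi) ^+ n * torus_mean f.
Proof. by rewrite mulrA divff ?mul1r// gt_eqF. Qed.

Let mbox := @measurable_box R n.

Lemma torus_meanD f g : ctorus f -> ctorus g ->
  torus_mean (fun x => f x + g x) = torus_mean f + torus_mean g.
Proof.
move=> /ctorus_integrable cf /ctorus_integrable cg; rewrite /torus_mean -mulrDr.
by congr (_ * _); exact: (RintegralD mbox cf cg).
Qed.

Lemma torus_meanZ (a : R) f : ctorus f ->
  torus_mean (fun x => a * f x) = a * torus_mean f.
Proof.
move=> /ctorus_integrable cf; rewrite /torus_mean mulrCA; congr (_ * _).
exact: (RintegralZl _ mbox cf).
Qed.

Lemma torus_meanN f : ctorus f -> torus_mean (fun x => - f x) = - torus_mean f.
Proof.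
move=> cf; rewrite -mulN1r -torus_meanZ//.
by apply: eq_torus_mean => x; rewrite mulN1r.
Qed.

Lemma torus_meanB f g : ctorus f -> ctorus g ->
  torus_mean (fun x => f x - g x) = torus_mean f - torus_mean g.
Proof. by move=> cf cg; rewrite torus_meanD ?torus_meanN//; exact: ctorusN. Qed.

Lemma torus_mean_wave nu c :
  torus_mean (wave nu c) = (nu == 0)%:R * cos c :> R.
Proof. by rewrite -[RHS](mulKf (lt0r_neq0 pin)) -Rintegral_box_wave. Qed.

Lemma torus_mean_cst (a : R) : torus_mean (fun _ : 'rV[R]_n => a) = a.
Proof.
have := torus_mean_wave (0 : 'rV[int]_n) 0; rewrite eqxx mul1r cos0 => m1.
rewrite -[RHS]mulr1 -m1 -torus_meanZ; last exact: ctorus_wave.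
by apply: eq_torus_mean => x; rewrite /wave intvec0 dotv0l add0r cos0 mulr1.
Qed.

Lemma le_torus_mean f g : ctorus f -> ctorus g -> (forall x, f x <= g x) ->
  torus_mean f <= torus_mean g.
Proof.
move=> /ctorus_integrable cf /ctorus_integrable cg fg.
rewrite ler_wpM2l//; first by rewrite invr_ge0 ltW.
exact: (le_Rintegral mbox cf cg (fun t _ => fg _)).
Qed.

Lemma norm_torus_mean_le f M : ctorus f -> (forall x, `|f x| <= M) ->
  `|torus_mean f| <= M.
Proof.
move=> cf fM; rewrite ler_norml -[X in _ && (_ <= X)](torus_mean_cst M).
rewrite -[X in - X](torus_mean_cst M) -torus_meanN; last exact: ctorus_cst.
have cM := ctorus_cst M.
apply/andP; split; apply: le_torus_mean => //.
- exact/ctorusN.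
- by move=> x; have := fM x; rewrite ler_norml => /andP[].
- by move=> x; rewrite (le_trans (ler_norm _)).
Qed.

Lemma norm_torus_mean f : ctorus f ->
  `|torus_mean f| <= torus_mean (fun x => `|f x|).
Proof.
move=> cf; rewrite ler_norml -torus_meanN; last exact: ctorus_norm.
have cn := ctorus_norm cf.
apply/andP; split; apply: le_torus_mean => //.
- exact/ctorusN.
- by move=> x; rewrite lerNl -normrN ler_norm.
- by move=> x; exact: ler_norm.
Qed.

Lemma torus_mean_sum (I : Type) (r : seq I) (P : pred I) (f : I -> 'rV[R]_n -> R) :
  (forall i, P i -> ctorus (f i)) ->
  torus_mean (fun x => \sum_(i <- r | P i) f i x) =
  \sum_(i <- r | P i) torus_mean (f i).
Proof.
move=> cf; elim: r => [|i r IH].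
  rewrite big_nil -[RHS](torus_mean_cst 0).
  by apply: eq_torus_mean => x; rewrite big_nil.
rewrite big_cons -IH; case: ifPn => Pi.
  rewrite -torus_meanD; [|exact: cf|exact: ctorus_sum].
  by apply: eq_torus_mean => x; rewrite big_cons Pi.
by apply: eq_torus_mean => x; rewrite big_cons (negbTE Pi).
Qed.

End torus_mean_theory.

(** * Fejer means *)

Section fejer.
Context {R : realType} {n : nat}.
Implicit Types (f g : 'rV[R]_n -> R) (x y z v : 'rV[R]_n) (nu : 'rV[int]_n).

Lemma wave_diff nu x y :
  cos (dotv (intvec nu) (x - y)) = wave (- nu) (dotv (intvec nu) x) y :> R.
Proof. by rewrite /wave intvecN dotvNl dotvDr dotvNr addrC. Qed.

Lemma torus_mean_wave_diff nu x :
  torus_mean (fun y => cos (dotv (intvec nu) (x - y))) = (nu == 0)%:R :> R.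
Proof.
rewrite (eq_torus_mean (wave_diff nu x)) torus_mean_wave oppr_eq0.
by case: eqP => [->|]; rewrite ?mul0r// intvec0 dotv0l cos0 mul1r.
Qed.

Lemma ctorus_cos_diff nu x : ctorus (fun y => cos (dotv (intvec nu) (x - y)) : R).
Proof.
rewrite (_ : (fun _ => _) = wave (- nu) (dotv (intvec nu) x)); first exact: ctorus_wave.
by apply/funext => y; rewrite wave_diff.
Qed.

Variable N : nat.
Local Notation K := {ffun 'I_n -> 'I_N.+1}.
Implicit Types k l : K.

Definition freq k : 'rV[int]_n := \row_i (k i)%:Z.

(** The product Fejer kernel |sum_k exp(i k.z)|^2 / (N+1)^n, k in {0, ..., N}^n, with the square
    expanded. Nonnegativity is then visible, and Fourier coefficients are obtained by counting pairs
    (k, l). *)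
Definition fejer z : R := (N.+1%:R ^+ n)^-1 *
  \sum_(k : K) \sum_(l : K) cos (dotv (intvec (freq k - freq l)) z).

Let Nn_gt0 : (0 : R) < N.+1%:R ^+ n. Proof. by rewrite exprn_gt0. Qed.

Lemma fejer_ge0 z : 0 <= fejer z.
Proof.
rewrite mulr_ge0 ?invr_ge0 ?(ltW Nn_gt0)//.
pose a k := dotv (intvec (freq k)) z : R.
suff -> : \sum_(k : K) \sum_(l : K) cos (dotv (intvec (freq k - freq l)) z) =
    (\sum_k cos (a k)) ^+ 2 + (\sum_k sin (a k)) ^+ 2 :> R.
  by rewrite addr_ge0 ?sqr_ge0.
rewrite !expr2 !mulr_suml -big_split/=; apply: eq_bigr => k _.
rewrite !mulr_sumr -big_split/=; apply: eq_bigr => l _.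
by rewrite intvecD intvecN dotvDl dotvNl cosB.
Qed.

Lemma ctorus_fejer : ctorus fejer.
Proof.
apply: ctorusZ; apply: ctorus_sum => k _; apply: ctorus_sum => l _.
rewrite (_ : (fun _ => _) = wave (freq k - freq l) 0); first exact: ctorus_wave.
by apply/funext => y; rewrite /wave addr0.
Qed.

Lemma freq_inj : injective freq.
Proof.
move=> k l /rowP kl; apply/ffunP => i; apply/val_inj.
by have := kl i; rewrite !mxE => -[].
Qed.

(** Only the pairs with k = l have frequency zero, and there are (N+1)^n of them. *)
Lemma torus_mean_fejer x : torus_mean (fun y => fejer (x - y)) = 1.
Proof.
rewrite torus_meanZ; last first.
  by apply: ctorus_sum => k _; apply: ctorus_sum => l _; exact: ctorus_cos_diff.
rewrite torus_mean_sum; last first.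
  by move=> k _; apply: ctorus_sum => l _; exact: ctorus_cos_diff.
rewrite (eq_bigr (fun=> 1)) => [|k _].
  rewrite sumr_const card_ffun !card_ord natrX.
  by rewrite mulVf// gt_eqF.
rewrite torus_mean_sum; last by move=> l _; exact: ctorus_cos_diff.
rewrite (bigD1 k)//= torus_mean_wave_diff subrr eqxx big1 ?addr0// => l lk.
rewrite torus_mean_wave_diff subr_eq0; case: eqP => // /freq_inj kl.
by rewrite kl eqxx in lk.
Qed.

(** Each k with k_i different from 0 has the partner l = k - e_i; the excluded k number
    (N+1)^(n-1). *)
Lemma fejer_count i :
  N.+1%:R ^+ n - N.+1%:R ^+ n.-1 <=
  \sum_(k : K) \sum_(l : K) (freq k - freq l == delta_mx 0 i)%:R :> R.
Proof.
have -> : N.+1%:R ^+ n - N.+1%:R ^+ n.-1 = \sum_(k : K) (k i != ord0)%:R :> R.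
  have E : \sum_(k : K) (k i == ord0)%:R = N.+1%:R ^+ n.-1 :> R.
    (* The indicator of k_i = 0 is written as a product over the coordinates, so that the sum over k
       factors. *)
    pose G (j : 'I_n) (m : 'I_N.+1) : R := if j == i then (m == ord0)%:R else 1.
    transitivity (\sum_(k : K) \prod_j G j (k j)).
      apply: eq_bigr => k _; rewrite (bigD1 i)//= /G eqxx big1 ?mulr1// => j.
      by move/negbTE->.
    rewrite -bigA_distr_bigA (bigD1 i)//= /G eqxx.
    rewrite (bigD1 ord0)//= big1 ?addr0 ?mul1r => [|m /negbTE-> //].
    rewrite (eq_bigr (fun=> N.+1%:R)) => [|j /negbTE->]; last first.
      by rewrite sumr_const card_ord.
    by rewrite prodr_const (cardC1 i) card_ord.
  rewrite -E; apply/eqP; rewrite subr_eq -big_split/=.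
  rewrite (eq_bigr (fun=> 1)) => [|k _]; last by case: eqP; rewrite ?addr0 ?add0r.
  by rewrite sumr_const card_ffun !card_ord natrX.
apply: ler_sum => k _; have [|ki0] := eqVneq (k i) ord0.
  by rewrite sumr_ge0.
pose l : K := [ffun j => if j == i then inord (k i).-1 else k j].
rewrite (bigD1 l)//= (_ : freq k - freq l == delta_mx 0 i).
  by rewrite lerDl sumr_ge0.
apply/eqP/rowP => j; rewrite !mxE ffunE; case: eqVneq => [->|ji]; last first.
  by rewrite subrr.
have k0 : (0 < k i)%N by rewrite lt0n; apply: contraNneq ki0 => k0; apply/eqP/val_inj.
rewrite inordK; last by rewrite prednK// ltnW// ltn_ord.
by rewrite -[X in X%:Z - _](prednK k0) intS addrK.
Qed.

(** Multiplication by cos (x_i - y_i) shifts frequencies by e_i and by - e_i, with weight 1/2 each,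
    so the mean counts the pairs with k - l equal to one of the two. Exchanging k and l shows that
    both counts agree, and [fejer_count] bounds them from below. *)
Lemma torus_mean_fejer_cos x i :
  torus_mean (fun y => (1 - cos (x 0 i - y 0 i)) * fejer (x - y)) <=
  N.+1%:R^-1.
Proof.
pose C (m : int) y : R := (N.+1%:R ^+ n)^-1 * \sum_(k : K) \sum_(l : K)
  cos (dotv (intvec (freq k - freq l - m *: delta_mx 0 i)) (x - y)).
have cC m : ctorus (C m).
  apply: ctorusZ; apply: ctorus_sum => k _; apply: ctorus_sum => l _.
  exact: ctorus_cos_diff.
have mC m : torus_mean (C m) = (N.+1%:R ^+ n)^-1 * \sum_(k : K) \sum_(l : K)
    (freq k - freq l == m *: delta_mx 0 i)%:R.
  rewrite torus_meanZ; last first.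
    by apply: ctorus_sum => k _; apply: ctorus_sum => l _; exact: ctorus_cos_diff.
  congr (_ * _); rewrite torus_mean_sum; last first.
    by move=> k _; apply: ctorus_sum => l _; exact: ctorus_cos_diff.
  apply: eq_bigr => k _.
  rewrite torus_mean_sum; last by move=> l _; exact: ctorus_cos_diff.
  by apply: eq_bigr => l _; rewrite torus_mean_wave_diff subr_eq0.
have cF : ctorus (fun y => fejer (x - y)) by apply: ctorus_refl; exact: ctorus_fejer.
have E y : (1 - cos (x 0 i - y 0 i)) * fejer (x - y) =
    fejer (x - y) - 2^-1 * (C 1 y + C (-1) y).
  rewrite mulrBl mul1r; congr (_ - _).
  rewrite /fejer /C -mulrDr mulrCA [RHS]mulrCA; congr (_ * _).
  rewrite -big_split/= !mulr_sumr; apply: eq_bigr => k _.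
  rewrite -big_split/= !mulr_sumr; apply: eq_bigr => l _.
  have D (m : int) : dotv (intvec (m *: delta_mx 0 i)) (x - y) =
      m%:~R * (x 0 i - y 0 i) :> R.
    rewrite (_ : intvec _ = m%:~R *: delta_mx 0 i).
      by rewrite dotvC dotvZr dotv_delta !mxE.
    apply/rowP => j; rewrite !mxE intrM; congr (_ * _).
    by case: (_ && _); rewrite ?mulr0z ?mulr1z.
  rewrite !(intvecD (freq k - freq l)) !(intvecN (_ *: _)).
  rewrite !(dotvDl (intvec (freq k - freq l))) !(dotvNl (intvec (_ *: _))) !D.
  rewrite mulrNz mulr1z mulN1r mul1r opprK.
  by move: (dotv _ _) (x 0 i - y 0 i) => A B; rewrite cosB cosD; field.
rewrite (eq_torus_mean E) torus_meanB//; last first.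
  by apply: ctorusZ; exact: (@ctorusD _ _ (C 1) (C (-1))).
rewrite (@torus_meanZ _ _ 2^-1); last exact: (@ctorusD _ _ (C 1) (C (-1))).
rewrite torus_meanD// torus_mean_fejer !mC.
have S : \sum_(k : K) \sum_(l : K) (freq k - freq l == -1 *: delta_mx 0 i)%:R =
    \sum_(k : K) \sum_(l : K) (freq k - freq l == 1 *: delta_mx 0 i)%:R :> R.
  rewrite exchange_big/=; apply: eq_bigr => k _; apply: eq_bigr => l _.
  by rewrite scaleN1r -eqr_opp opprK opprB scale1r.
have half (z : R) : 2^-1 * (z + z) = z by field.
rewrite S half scale1r.
have := fejer_count i; rewrite -(ler_pM2l (x := (N.+1%:R ^+ n)^-1)) ?invr_gt0//.
rewrite mulrBr mulVf ?gt_eqF//.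
have -> : (N.+1%:R ^+ n)^-1 * N.+1%:R ^+ n.-1 = N.+1%:R^-1 :> R.
  case: n i {x cC mC cF E S C} => [[]//|m] _ /=.
  by rewrite exprS invfM -mulrA mulVf ?mulr1// expf_neq0.
by rewrite lerBlDl => H; rewrite lerBlDr.
Qed.

Definition fejer_mean f x : R := torus_mean (fun y => f y * fejer (x - y)).

(** Korovkin's argument: a modulus of continuity expressed through 1 - cos is integrated against a
    nonnegative kernel of mean 1, so only the n test values of [torus_mean_fejer_cos] enter. *)
Lemma fejer_mean_approx f e C : ctorus f -> 0 <= C ->
  (forall x y, `|f x - f y| <= e + C * \sum_(i < n) (1 - cos (x 0 i - y 0 i))) ->
  forall x, `|fejer_mean f x - f x| <= e + C * n%:R / N.+1%:R.
Proof.
move=> cf C0 fC x.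
have cF : ctorus (fun y => fejer (x - y)) by apply: ctorus_refl; exact: ctorus_fejer.
have -> : fejer_mean f x - f x = torus_mean (fun y => (f y - f x) * fejer (x - y)).
  rewrite -[in LHS](mulr1 (f x)) -(torus_mean_fejer x) -torus_meanZ// -torus_meanB.
  - by apply: eq_torus_mean => y; rewrite mulrBl.
  - exact: ctorusM.
  - exact: ctorusZ.
have c1 : ctorus (fun y => f y - f x) by apply: ctorusB => //; exact: ctorus_cst.
have ccos i : ctorus (fun y : 'rV[R]_n => 1 - cos (x 0 i - y 0 i)).
  apply: ctorusB; first exact: ctorus_cst.
  rewrite (_ : (fun _ => _) = (fun y => cos (dotv (intvec (delta_mx 0 i)) (x - y)))).
    exact: ctorus_cos_diff.
  apply/funext => y; rewrite (_ : intvec _ = delta_mx 0 i).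
    by rewrite dotvC dotv_delta !mxE.
  by apply/rowP => j; rewrite !mxE; case: (_ && _); rewrite ?mulr0z ?mulr1z.
have cS : ctorus (fun y => \sum_(i < n) (1 - cos (x 0 i - y 0 i)) * fejer (x - y)).
  by apply: ctorus_sum => i _; exact: ctorusM.
apply: (le_trans (norm_torus_mean _)); first exact: ctorusM.
apply: (@le_trans _ _ (torus_mean (fun y => e * fejer (x - y) +
    C * \sum_(i < n) (1 - cos (x 0 i - y 0 i)) * fejer (x - y)))).
  apply: le_torus_mean.
  - exact/ctorus_norm/ctorusM.
  - by apply: ctorusD; exact: ctorusZ.
  - move=> y; rewrite normrM (ger0_norm (fejer_ge0 _)) -mulr_suml (mulrA C) -mulrDl.
    by rewrite ler_wpM2r ?fejer_ge0// distrC.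
rewrite torus_meanD; [|exact: ctorusZ|exact: ctorusZ].
rewrite (@torus_meanZ _ _ e)// (@torus_meanZ _ _ C)//.
rewrite torus_mean_fejer mulr1 lerD2l -mulrA ler_wpM2l//.
rewrite torus_mean_sum => [|i _]; last exact: ctorusM.
rewrite -[n in n%:R]card_ord mulr_natl -sumr_const; apply: ler_sum => i _.
exact: torus_mean_fejer_cos.
Qed.

End fejer.

Lemma fejer_mean_unif {R : realType} {n : nat} (f : 'rV[R]_n -> R) e :
  ctorus f -> 0 < e ->
  \forall N \near \oo, forall x, `|fejer_mean N f x - f x| <= e.
Proof.
move=> cf e0.
have [|C C0 HC] := torus_modulus (e := e / 2) cf.1 cf.2; first by rewrite divr_gt0.
near=> N => x.
apply: (le_trans (fejer_mean_approx N cf C0 HC x)).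
rewrite [leRHS]splitr lerD2l ler_pdivrMr//.
rewrite -ler_pdivrMl ?divr_gt0//.
apply: (@le_trans _ _ N%:R); last by rewrite ler_nat.
by near: N; exact: nbhs_infty_ger.
Unshelve. all: by end_near. Qed.

(** * Trigonometric polynomials, invariance of the mean, uniqueness of representatives *)

Section trigonometric_polynomials.
Context {R : realType} {n : nat}.
Implicit Types (f g : 'rV[R]_n -> R) (x y z v : 'rV[R]_n) (nu : 'rV[int]_n).
Implicit Types (s : seq (R * 'rV[int]_n * R)).

(** A polynomial is a list of triples (coefficient, frequency, phase), with repetitions allowed: the
    operators act term by term, so no normal form is required. *)
Definition trig s x : R := \sum_(p <- s) p.1.1 * wave p.1.2 p.2 x.

Definition is_trig f := exists s, f =1 trig s.

Lemma trig_cat s1 s2 x : trig (s1 ++ s2) x = trig s1 x + trig s2 x.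
Proof. exact: big_cat. Qed.

Lemma is_trigD f g : is_trig f -> is_trig g -> is_trig (fun x => f x + g x).
Proof.
by move=> [s1 fs] [s2 gs]; exists (s1 ++ s2) => x; rewrite fs gs trig_cat.
Qed.

Lemma is_trigZ (a : R) f : is_trig f -> is_trig (fun x => a * f x).
Proof.
move=> [s fs]; exists [seq (a * p.1.1, p.1.2, p.2) | p <- s] => x.
rewrite fs /trig big_map mulr_sumr; apply: eq_bigr => p _ /=.
by rewrite mulrA.
Qed.

Lemma is_trig_wave nu c : is_trig (wave nu c).
Proof. by exists [:: (1, nu, c)] => x; rewrite /trig big_seq1 mul1r. Qed.

Lemma is_trig_sum (I : Type) (r : seq I) (f : I -> 'rV[R]_n -> R) :
  (forall i, is_trig (f i)) -> is_trig (fun x => \sum_(i <- r) f i x).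
Proof.
move=> tf; elim: r => [|i r IH].
  by exists [::] => x; rewrite /trig !big_nil.
have [s sE] := is_trigD (tf i) IH.
by exists s => x; rewrite big_cons -sE.
Qed.

Lemma ctorus_trig s : ctorus (trig s).
Proof. by apply: ctorus_sum => p _; apply: ctorusZ; exact: ctorus_wave. Qed.

Lemma torus_mean_trig s :
  torus_mean (trig s) = \sum_(p <- s) p.1.1 * ((p.1.2 == 0)%:R * cos p.2).
Proof.
rewrite torus_mean_sum => [|p _]; last by apply: ctorusZ; exact: ctorus_wave.
apply: eq_bigr => p _; rewrite torus_meanZ ?torus_mean_wave//; exact: ctorus_wave.
Qed.

(** The addition formula for cos (a - b) separates x from y; the sine is the wave of phase - pi/2.
    Convolution with a wave is thus a trigonometric polynomial in x. *)
Lemma torus_mean_conv_wave f nu x : ctorus f ->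
  torus_mean (fun y => f y * cos (dotv (intvec nu) (x - y))) =
  torus_mean (fun y => f y * wave nu 0 y) * wave nu 0 x +
  torus_mean (fun y => f y * wave nu (- (pi / 2)) y) * wave nu (- (pi / 2)) x.
Proof.
move=> cf; have cfw c : ctorus (fun y => f y * wave nu c y).
  by apply: ctorusM => //; exact: ctorus_wave.
rewrite mulrC -torus_meanZ// [X in _ + X]mulrC -torus_meanZ// -torus_meanD.
- apply: eq_torus_mean => y; rewrite /wave !addr0 !cosBpihalf dotvDr dotvNr cosB.
  ring.
- exact: ctorusZ.
- exact: ctorusZ.
Qed.

Lemma is_trig_fejer_mean N f : ctorus f -> is_trig (fejer_mean N f).
Proof.
move=> cf.
pose K := {ffun 'I_n -> 'I_N.+1}.
pose A nu : R := torus_mean (fun y => f y * wave nu 0 y).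
pose B nu : R := torus_mean (fun y => f y * wave nu (- (pi / 2)) y).
suff [s sE] : is_trig (fun x => (N.+1%:R ^+ n)^-1 * \sum_(k : K) \sum_(l : K)
    (A (freq k - freq l) * wave (freq k - freq l) 0 x +
     B (freq k - freq l) * wave (freq k - freq l) (- (pi / 2)) x)).
  exists s => x; rewrite -sE /fejer_mean /fejer.
  have cfd nu : ctorus (fun y => f y * cos (dotv (intvec nu) (x - y))).
    by apply: ctorusM => //; exact: ctorus_cos_diff.
  under eq_torus_mean => y do rewrite mulrCA mulr_sumr.
  have cs k : ctorus (fun y => f y *
      (\sum_(l : K) cos (dotv (intvec (freq k - freq l)) (x - y)))).
    by apply: ctorusM => //; apply: ctorus_sum => l _; exact: ctorus_cos_diff.
  rewrite torus_meanZ; last exact: ctorus_sum.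
  congr (_ * _); rewrite torus_mean_sum; last by move=> k _; exact: cs.
  apply: eq_bigr => k _.
  under eq_torus_mean => y do rewrite mulr_sumr.
  rewrite torus_mean_sum; last by move=> l _; exact: cfd.
  by apply: eq_bigr => l _; rewrite torus_mean_conv_wave.
apply: is_trigZ; apply: is_trig_sum => k; apply: is_trig_sum => l.
by apply: is_trigD; apply: is_trigZ; exact: is_trig_wave.
Qed.

(** The box is not invariant under reflections, so the equality is checked on waves, where the mean
    is explicit, and passed to the uniform limit of the Fejer means. These are defined with the
    kernel at x - y, so their convergence does not rest on this invariance. *)
Lemma torus_mean_refl f v : ctorus f -> torus_mean (fun y => f (v - y)) = torus_mean f.
Proof.
move=> cf; apply/eqP; rewrite -subr_eq0 -normr_le0; apply/ler_addgt0Pr => e e0.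
rewrite add0r.
have [N _ /(_ N (leqnn N)) HN] := fejer_mean_unif cf (divr_gt0 e0 (ltr0n _ 2)).
have [s sE] := is_trig_fejer_mean N cf.
have cs := ctorus_trig s.
have ms : torus_mean (fun y => trig s (v - y)) = torus_mean (trig s).
  rewrite [RHS]torus_mean_trig torus_mean_sum => [|p _]; last first.
    by apply: ctorusZ; exact/ctorus_refl/ctorus_wave.
  apply: eq_bigr => p _; rewrite torus_meanZ; last exact/ctorus_refl/ctorus_wave.
  congr (_ * _).
  rewrite (_ : (fun y => _) = wave (- p.1.2) (dotv (intvec p.1.2) v + p.2)).
    rewrite torus_mean_wave oppr_eq0; case: eqP => [->|]; rewrite ?mul0r//.
    by rewrite intvec0 dotv0l add0r.
  apply/funext => y; rewrite /wave intvecN dotvNl dotvDr dotvNr; congr cos.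
  ring.
have le2 g : ctorus g -> (forall x, `|g x| <= e / 2) -> `|torus_mean g| <= e / 2.
  exact: norm_torus_mean_le.
have cfv := ctorus_refl v cf; have csv := ctorus_refl v cs.
have -> : torus_mean (fun y => f (v - y)) - torus_mean f =
    torus_mean (fun y => f (v - y) - trig s (v - y)) +
    torus_mean (fun y => trig s y - f y).
  by rewrite !torus_meanB// ms; ring.
rewrite [leRHS]splitr (le_trans (ler_normD _ _))// lerD//; apply: le2.
- exact: ctorusB.
- by move=> x; rewrite -sE distrC; exact: HN.
- exact: ctorusB.
- by move=> x; rewrite -sE; exact: HN.
Qed.

(** A translation is a composite of two reflections. *)
Lemma torus_mean_shift f v : ctorus f -> torus_mean (fun y => f (y + v)) = torus_mean f.
Proof.
move=> cf; rewrite -(torus_mean_refl 0 cf) -(torus_mean_refl (- v) (ctorus_refl 0 cf)).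
by apply: eq_torus_mean => y; rewrite sub0r opprB opprK.
Qed.

Lemma fejer_meanE N f x : ctorus f ->
  fejer_mean N f x = torus_mean (fun y => f (x - y) * fejer N y).
Proof.
move=> cf; rewrite /fejer_mean -(@torus_mean_refl _ x).
  by apply: eq_torus_mean => y; rewrite subKr.
by apply: ctorusM => //; apply: ctorus_refl; exact: ctorus_fejer.
Qed.

(** Once the variable has been moved onto f, both means average against the same nonnegative kernel
    of mean 1. Fejer means therefore inherit any translation-invariant modulus of continuity of
    f. *)
Lemma fejer_mean_dist N f x x' D : ctorus f ->
  (forall y, `|f (x - y) - f (x' - y)| <= D) ->
  `|fejer_mean N f x - fejer_mean N f x'| <= D.
Proof.
move=> cf fD; have cF := @ctorus_fejer R n N.
have c1 := ctorus_refl x cf; have c2 := ctorus_refl x' cf.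
have F1 : torus_mean (@fejer R n N) = 1.
  by rewrite -(torus_mean_refl 0 cF); exact: torus_mean_fejer.
rewrite !fejer_meanE// -torus_meanB; [|exact: ctorusM|exact: ctorusM].
have c3 : ctorus (fun y => f (x - y) * fejer N y - f (x' - y) * fejer N y).
  by apply: ctorusB; exact: ctorusM.
apply: (le_trans (norm_torus_mean c3)).
rewrite -[D]mulr1 -F1 -torus_meanZ//; apply: le_torus_mean.
- exact: ctorus_norm.
- exact: ctorusZ.
- by move=> y; rewrite -mulrBl normrM (ger0_norm (fejer_ge0 _ _)) ler_wpM2r// fejer_ge0.
Qed.

Lemma is_derive_line f x v df :
  is_derive (0 : R) (1 : R) (fun t : R => f (t *: v + x)) df -> is_derive x v f df.
Proof.
move=> [d1 d2].
have E : (fun h : R => h^-1 *: ((f \o shift x) (h *: v) - f x)) =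
    (fun h : R => h^-1 *: (((fun t : R => f (t *: v + x)) \o shift 0) (h *: (1 : R)) -
      f (0 *: v + x))).
  apply/funext => h /=; rewrite addr0 scale0r add0r.
  by congr (_ *: (f (_ *: _ + _) - _)); rewrite /GRing.scale/= mulr1.
split; first by rewrite /derivable E; exact: d1.
by rewrite -d2 /derive E.
Qed.

Lemma is_derive_wave nu c x i :
  is_derive x ('e_i : 'rV[R]_n) (wave nu c)
    ((nu 0 i)%:~R * wave nu (c + pi / 2) x).
Proof.
apply: is_derive_line.
rewrite (_ : (fun t : R => _) =
    (fun t => cos ((nu 0 i)%:~R * t + (dotv (intvec nu) x + c)))); last first.
  apply/funext => t; rewrite /wave; congr cos.
  by rewrite dotvDr dotvZr dotv_delta mxE addrA mulrC.
have -> : wave nu (c + pi / 2) x = - sin (dotv (intvec nu) x + c).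
  by rewrite /wave addrA cosDpihalf.
apply: is_derive_eq.
rewrite mulr0 add0r addr0 /GRing.scale/= mulr1.
by rewrite mulrC.
Qed.

Definition trig_deriv i s : seq (R * 'rV[int]_n * R) :=
  [seq (p.1.1 * (p.1.2 0 i)%:~R, p.1.2, p.2 + pi / 2) | p : R * 'rV[int]_n * R <- s].

Lemma is_derive_trig s x i :
  is_derive x ('e_i : 'rV[R]_n) (trig s) (trig (trig_deriv i s) x).
Proof.
elim: s => [|p s IH].
  have -> : trig [::] = cst 0 by apply/funext => y; rewrite /trig big_nil.
  exact: is_derive_cst.
rewrite (_ : trig (p :: s) =
  (p.1.1 \*: (wave p.1.2 p.2 : 'rV[R]_n -> R^o)) + trig s); last first.
  by apply/funext => y; rewrite /trig big_cons.
rewrite /trig/= big_cons /= -mulrA.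
by apply: is_deriveD; apply: is_deriveZ; exact: is_derive_wave.
Qed.

Lemma smooth_trig s : smooth_torus (trig s).
Proof.
split; first exact: (ctorus_trig s).1.
move=> l /=.
have [s' ->] : exists s', foldl partial_derivative (trig s) l = trig s'.
  elim: l s => [|i l IH] s; first by exists s.
  rewrite /= (_ : partial_derivative (trig s) i = trig (trig_deriv i s)); first exact: IH.
  apply/funext => x; have Ds := is_derive_trig s x i.
  exact: derive_val.
split; first exact: (ctorus_trig s').2.
by move=> x i; have [] := is_derive_trig s' x i.
Qed.

(** Uniqueness of the continuous function behind a distribution. The test function is the Fejer
    kernel centred at x, a trigonometric polynomial: all Fejer means of f - g vanish at x, yet they
    converge to f - g. *)
Lemma ctorus_eq f g : ctorus f -> ctorus g ->
  (forall phi, smooth_torus phi ->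
    torus_mean (fun x => f x * phi x) = torus_mean (fun x => g x * phi x)) ->
  f =1 g.
Proof.
move=> cf cg fg x; apply/eqP; rewrite -subr_eq0 -normr_le0.
apply/ler_addgt0Pr => e e0; rewrite add0r.
have [N _ /(_ N (leqnn N))/(_ x)] := fejer_mean_unif (ctorusB cf cg) e0.
suff -> : fejer_mean N (fun x => f x - g x) x = 0 by rewrite sub0r normrN.
have cF : ctorus (fun y => fejer N (x - y)) by apply: ctorus_refl; exact: ctorus_fejer.
have -> : fejer_mean N (fun x => f x - g x) x =
    torus_mean (fun y => f y * fejer N (x - y)) -
    torus_mean (fun y => g y * fejer N (x - y)).
  rewrite -torus_meanB; [|exact: ctorusM|exact: ctorusM].
  by apply: eq_torus_mean => y; rewrite mulrBl.
have [s sE] : is_trig (fun y => fejer N (x - y)).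
  apply: is_trigZ; apply: is_trig_sum => k; apply: is_trig_sum => l.
  have [s sE] := is_trig_wave (- (freq k - freq l)) (dotv (intvec (freq k - freq l)) x).
  by exists s => y; rewrite -sE wave_diff.
have sE' : (fun y => fejer N (x - y)) = trig s by exact/funext.
have /fg := smooth_trig s.
by rewrite -sE' => ->; rewrite subrr.
Qed.

End trigonometric_polynomials.

(** * The binomial series and the random walk *)

Section binomial_weights.
Context {R : realType}.

(** Young's inequality for the product of x^p and 1, with exponents 1/p and 1/(1-p). *)
Lemma powR_bernoulli (x p : R) : 0 <= x -> 0 < p < 1 -> x `^ p <= 1 + p * (x - 1).
Proof.
move=> x0 /andP[p0 p1].
have q0 : 0 < 1 - p by rewrite subr_gt0.
have := @conjugate_powR R (x `^ p) 1 p^-1 (1 - p)^-1.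
rewrite powR_ge0 ler01 !invr_gt0 p0 q0 !invrK => /(_ isT isT isT isT).
rewrite addrC subrK => /(_ erefl).
rewrite mulr1 -powRrM mulfV ?gt_eqF// powRr1// powR1 => /le_trans; apply.
by rewrite le_eqVlt; apply/orP; left; apply/eqP; ring.
Qed.

(** The coefficient of t^k in the power series of (1 - t)^(s-1). *)
Definition binw (s : R) k : R := \prod_(j < k) (1 - s / j.+1%:R).

Lemma binwS s k : binw s k.+1 = binw s k * (1 - s / k.+1%:R).
Proof. by rewrite /binw big_ord_recr. Qed.

Variable s : R.
Hypothesis s01 : 0 < s < 1.
Let s0 : 0 < s. Proof. by case/andP: s01. Qed.
Let s1 : s < 1. Proof. by case/andP: s01. Qed.

Lemma binw_factor k : 0 <= 1 - s / k.+1%:R <= 1.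
Proof.
rewrite subr_ge0 ler_pdivrMr// mul1r gerBl divr_ge0 ?(ltW s0)// andbT.
by rewrite (le_trans (ltW s1))// ler1n.
Qed.

Lemma binw_ge0 k : 0 <= binw s k.
Proof. by apply: prodr_ge0 => j _; case/andP: (binw_factor j). Qed.

Lemma binw_le1 k : binw s k <= 1.
Proof.
elim: k => [|k IH]; first by rewrite /binw big_ord0.
have [f0 f1] := andP (binw_factor k).
by rewrite binwS mulr_ile1 ?binw_ge0.
Qed.

Lemma binw_dec k : 0 <= binw s k - binw s k.+1.
Proof.
rewrite subr_ge0 binwS ler_piMr ?binw_ge0//.
by case/andP: (binw_factor k).
Qed.

(** With u = s/(k+1), the induction step asks that ((k+2)/(k+1))^s (1 - u) be at most 1; by
    Bernoulli it is at most (1 + u)(1 - u). *)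
Lemma binw_le k : binw s k <= k.+1%:R `^ (- s).
Proof.
elim: k => [|k IH]; first by rewrite /binw big_ord0 powR1.
have k1 : (0 : R) < k.+1%:R by []; have k2 : (0 : R) < k.+2%:R by [].
have [f0 f1] := andP (binw_factor k).
rewrite binwS; apply: (le_trans (ler_wpM2r f0 IH)).
have -> : k.+2%:R = k.+1%:R * (k.+2%:R / k.+1%:R) :> R.
  by rewrite mulrC divfK.
rewrite powRM ?divr_ge0//.
rewrite ler_wpM2l ?powR_ge0//.
rewrite powRN -[leLHS]invrK lef_pV2 ?posrE ?invr_gt0 ?powR_gt0 ?divr_gt0//; last first.
  by rewrite subr_gt0 ltr_pdivrMr// mul1r (lt_le_trans s1)// ler1n.
have := @powR_bernoulli (k.+2%:R / k.+1%:R) s.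
rewrite divr_ge0// => /(_ isT s01) /le_trans; apply.
have -> : k.+2%:R / k.+1%:R - 1 = k.+1%:R^-1 :> R.
  by rewrite -[k.+2%:R]natr1 mulrDl divff// mul1r addrC addKr.
rewrite -[leRHS]div1r ler_pdivlMr; last first.
  by rewrite subr_gt0 ltr_pdivrMr// mul1r (lt_le_trans s1)// ler1n.
have -> : (1 + s / k.+1%:R) * (1 - s / k.+1%:R) = 1 - (s / k.+1%:R) ^+ 2 by ring.
by rewrite gerBl sqr_ge0.
Qed.

(** The left side is at most s (k+1)^(g-s-1), and the increment of the power g - s is at least (g -
    s)(k+1)^(g-s-1). The condition 2 s <= g says that s <= g - s, so the sum telescopes with
    constant 1, whatever s is. *)
Lemma binw_step (g : R) k : 2 * s <= g -> g < 1 ->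
  (binw s k - binw s k.+1) * k.+1%:R `^ g <= k.+1%:R `^ (g - s) - k%:R `^ (g - s).
Proof.
move=> sg g1; have k1 : (0 : R) < k.+1%:R by [].
have /andP[s0' s1'] := s01.
have gs01 : 0 < g - s < 1 by apply/andP; split; lra.
have -> : binw s k - binw s k.+1 = binw s k * (s / k.+1%:R) by rewrite binwS; ring.
apply: (@le_trans _ _ (k.+1%:R `^ (- s) * (s / k.+1%:R) * k.+1%:R `^ g)).
  by rewrite ler_wpM2r ?powR_ge0// ler_wpM2r ?binw_le// divr_ge0// ltW.
rewrite mulrAC -powRD; last by rewrite (gt_eqF k1) implybT.
rewrite (addrC (- s)).
have -> : k%:R = k.+1%:R * (k%:R / k.+1%:R) :> R by rewrite mulrC divfK.
rewrite powRM ?divr_ge0//.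
rewrite -[X in _ <= X - _]mulr1 -mulrBr ler_wpM2l ?powR_ge0//.
have := @powR_bernoulli (k%:R / k.+1%:R) (g - s).
rewrite divr_ge0// => /(_ isT gs01).
have -> : k%:R / k.+1%:R - 1 = - k.+1%:R^-1 :> R.
  have -> : k%:R = k.+1%:R - 1 :> R by rewrite -natr1 addrK.
  by rewrite mulrBl divff// mul1r addrAC subrr sub0r.
have : s / k.+1%:R <= (g - s) / k.+1%:R.
  by rewrite ler_pM2r ?invr_gt0//; lra.
rewrite mulrN; move: (s / _) ((g - s) / _) (_ `^ _) => a b p; lra.
Qed.

Lemma binw_abel (d : nat -> R) m : d 0 = 0 ->
  \sum_(k < m) binw s k * (d k.+1 - d k) =
  \sum_(k < m) (binw s k - binw s k.+1) * d k.+1 + binw s m * d m.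
Proof.
move=> d0; elim: m => [|m IH]; first by rewrite !big_ord0 d0 mulr0 addr0.
by rewrite !big_ord_recr/= IH; ring.
Qed.

(* For the random walk of step K^{-1/2}, [d k] is the change in [k] steps and [g]
   is half the Hoelder exponent; the constant [c + B] does not depend on [s]. *)
Lemma binw_sum_le (g c B : R) (K m : nat) (d : nat -> R) :
  2 * s <= g -> g < 1 -> 0 <= c -> 0 <= B -> (0 < K <= m)%N -> d 0 = 0 ->
  (forall k, `|d k| <= c * (k%:R / K%:R) `^ g) -> (forall k, `|d k| <= B) ->
  `|\sum_(k < m) binw s k * (d k.+1 - d k)| <= (c + B) * K%:R `^ (- s).
Proof.
move=> sg g1 c0 B0 /andP[K0 Km] d0 dc dB.
have KR : (0 : R) < K%:R by rewrite ltr0n.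
rewrite binw_abel//.
(* Up to time K the Hoelder bound on d is summed through [binw_step]. *)
have HK j : `|\sum_(k < j) (binw s k - binw s k.+1) * d k.+1| <=
    c * K%:R `^ (- g) * j%:R `^ (g - s).
  elim: j => [|j IH].
    by rewrite big_ord0 normr0 !mulr_ge0 ?powR_ge0.
  rewrite big_ord_recr/= (le_trans (ler_normD _ _))//.
  have := dc j.+1; rewrite powRM ?invr_ge0// -powR_inv1 -?powRrM ?mulN1r// => H.
  apply: (@le_trans _ _ (c * K%:R `^ (- g) * j%:R `^ (g - s) +
      c * K%:R `^ (- g) * ((binw s j - binw s j.+1) * j.+1%:R `^ g))).
    rewrite lerD// normrM (ger0_norm (binw_dec _)).
    apply: (le_trans (ler_wpM2l (binw_dec _) H)).
    by rewrite le_eqVlt; apply/orP; left; apply/eqP; ring.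
  rewrite -mulrDr ler_wpM2l ?mulr_ge0 ?powR_ge0//.
  by have := binw_step j sg g1; lra.
(* After time K only the uniform bound B is used, and the weights telescope; the boundary term B b_m
   of the Abel summation then leaves B b_K, which is at most B K^(-s). *)
have Hm j : `|\sum_(k < K + j) (binw s k - binw s k.+1) * d k.+1| <=
    c * K%:R `^ (- g) * K%:R `^ (g - s) + B * (binw s K - binw s (K + j)).
  elim: j => [|j IH]; first by rewrite addn0 subrr mulr0 addr0; exact: HK.
  rewrite addnS big_ord_recr/= (le_trans (ler_normD _ _))//.
  rewrite (le_trans (lerD IH (lexx _)))//.
  rewrite normrM (ger0_norm (binw_dec _)).
  have := ler_wpM2l (binw_dec (K + j)) (dB (K + j).+1).
  by lra.
have := Hm (m - K)%N; rewrite subnKC// -mulrA -powRD; last by rewrite (gt_eqF KR) implybT.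
rewrite (_ : - g + (g - s) = - s); last by ring.
move=> H; apply: (le_trans (ler_normD _ _)).
rewrite normrM (ger0_norm (binw_ge0 _)).
have := ler_wpM2l (binw_ge0 m) (dB m).
have bK : binw s K <= K%:R `^ (- s).
  apply: (le_trans (binw_le K)).
  rewrite !powRN lef_pV2 ?posrE ?powR_gt0//.
  by rewrite ge0_ler_powR ?nnegrE// ?ler_nat// ltW.
have := ler_wpM2l B0 bK.
by move: H; lra.
Qed.

Definition binsum m (t : R) : R := \sum_(k < m) binw s k * t ^+ k.

Definition binsum' m (t : R) : R := \sum_(k < m) binw s k * (k%:R * t ^+ k.-1).

Lemma is_derive_binsum m (t : R) : is_derive t (1 : R) (binsum m) (binsum' m t).
Proof.
elim: m => [|m IH].
  have -> : binsum 0 = cst 0 by apply/funext => u; rewrite /binsum big_ord0.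
  by rewrite /binsum' big_ord0; exact: is_derive_cst.
have -> : binsum m.+1 = binsum m + (binw s m \*: (fun u : R => u ^+ m : R^o)).
  by apply/funext => u; rewrite /binsum big_ord_recr.
rewrite /binsum' big_ord_recr/=.
apply: is_deriveD; apply: is_deriveZ.
apply: DeriveDef; first exact: exprn_derivable.
by rewrite exp_derive /GRing.scale/= mulr1.
Qed.

(** (1 - t)^(s-1) solves (1 - t) y' = (1 - s) y. For a partial sum, the recurrence (k+1) b_(k+1) =
    (k+1-s) b_k cancels every power of t but the last. *)
Lemma binsum_ode m (t : R) :
  (1 - t) * binsum' m.+1 t - (1 - s) * binsum m.+1 t = - (m.+1%:R * binw s m.+1 * t ^+ m).
Proof.
elim: m => [|m IH].
  by rewrite /binsum' /binsum !big_ord1 binwS /= /binw big_ord0; field.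
rewrite /binsum' /binsum big_ord_recr/= [X in _ - _ * X]big_ord_recr/=.
rewrite -/(binsum' m.+1 t) -/(binsum m.+1 t).
have -> : (1 - t) * (binsum' m.+1 t + binw s m.+1 * (m.+1%:R * t ^+ m)) -
   (1 - s) * (binsum m.+1 t + binw s m.+1 * t ^+ m.+1) =
   ((1 - t) * binsum' m.+1 t - (1 - s) * binsum m.+1 t) +
   ((1 - t) * (binw s m.+1 * (m.+1%:R * t ^+ m)) - (1 - s) * binw s m.+1 * t ^+ m.+1).
  by ring.
rewrite IH (binwS s m.+1) exprS -[m.+2%:R]natr1; field.
by rewrite nat1r natr1 pnatr_eq0.
Qed.

(* The derivative of [(1 - t) `^ (1 - s) * binsum m t] consists of the single
   term coming from the truncation of the binomial series. *)
Lemma binsum_approx m (q : R) : 0 <= q < 1 ->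
  `|(1 - q) * binsum m.+1 q - (1 - q) `^ s| <= m.+1%:R * q ^+ m.+1.
Proof.
move=> /andP[q0 q1].
(* The factor (1 - t)^(1-s) is written with [expR] and [ln] in order to be differentiated; with the
   full series, G would be constantly 1. *)
pose G t : R := expR ((1 - s) * ln (1 - t)) * binsum m.+1 t.
pose G' t : R := - (expR (- s * ln (1 - t)) * (m.+1%:R * binw s m.+1 * t ^+ m)).
have dG (t : R) : t < 1 -> is_derive t (1 : R) G (G' t).
  move=> t1; have t0 : 0 < 1 - t by rewrite subr_gt0.
  have dl : is_derive t (1 : R) (fun u : R => ln (1 - u)) (- (1 - t)^-1).
    have dl1 := is_derive1_ln t0.
    apply: is_derive_eq.
    by rewrite /GRing.scale/= add0r mul1r mulrN1.
  have dB := is_derive_binsum m.+1 t.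
  apply: is_derive_eq.
  rewrite /GRing.scale/=.
  have -> : expR ((1 - s) * ln (1 - t)) = (1 - t) * expR (- s * ln (1 - t)).
    by rewrite -{2}[1 - t]lnK ?posrE// -expRD; congr expR; ring.
  have := binsum_ode m t => H.
  rewrite /G' -mulrN -H; field.
  by rewrite gt_eqF.
have G0 : G 0 = 1.
  rewrite /G subr0 ln1 mulr0 expR0 mul1r /binsum big_ord_recl/= expr0 mulr1.
  rewrite /binw big_ord0 big1 ?addr0// => i _.
  by rewrite expr0n/= mulr0.
have EG : (1 - q) * binsum m.+1 q = (1 - q) `^ s * G q.
  rewrite /G mulrA /powR subr_eq0 eq_sym lt_eqF// -expRD -mulrDl.
  rewrite (_ : s + (1 - s) = 1); last by ring.
  by rewrite mul1r lnK// posrE subr_gt0.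
rewrite EG -[X in _ - X]mulr1 -mulrBr normrM (ger0_norm (powR_ge0 _ _)).
have -> : G q - 1 = G q - G 0 by rewrite G0.
move: q0; rewrite le_eqVlt => /predU1P[<-|q0].
  by rewrite subrr normr0 mulr0 mulr_ge0// exprn_ge0.
have [||c] := @MVT R G G' 0 q q0.
- by move=> t; rewrite in_itv/= => /andP[_ t1]; apply: dG; rewrite (lt_trans t1).
- apply: derivable_within_continuous => t; rewrite in_itv/= => /andP[_ t1].
  by have [] := dG t (le_lt_trans t1 q1).
rewrite in_itv/= => /andP[c0 cq] ->; rewrite subr0.
rewrite /G' mulNr normrN normrM (ger0_norm (ltW q0)) normrM ger0_norm ?expR_ge0//.
rewrite ger0_norm; last by rewrite !mulr_ge0 ?binw_ge0// exprn_ge0// ltW.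
have -> : (1 - q) `^ s = expR (s * ln (1 - q)).
  by rewrite /powR subr_eq0 eq_sym lt_eqF.
rewrite !mulrA -expRD.
(* The mean value point c is below q, so (1-q)^s (1-c)^(-s) is at most 1 and c^m at most q^m; the
   weight is at most 1. *)
apply: (@le_trans _ _ (1 * (m.+1%:R * 1 * q ^+ m) * q)); last first.
  by rewrite exprSr mulrA mul1r mulr1 mulrA.
rewrite ler_wpM2r ?(ltW q0)// -!mulrA ler_pM ?expR_ge0//.
- by rewrite !mulr_ge0 ?binw_ge0// exprn_ge0// ltW.
- have c1 : 0 < 1 - c by rewrite subr_gt0 (lt_trans cq).
  have q1' : 0 < 1 - q by rewrite subr_gt0.
  rewrite -[leRHS]expR0 ler_expR mulNr subr_le0 ler_pM2l// ler_ln ?posrE//.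
  by rewrite lerB// ltW.
rewrite ler_wpM2l// ler_pM ?binw_ge0 ?exprn_ge0 ?binw_le1 ?(ltW c0)//.
by rewrite lerXn2r ?nnegrE ?(ltW c0) ?(ltW q0)// ltW.
Qed.

Lemma cvg_binsum (q : R) : 0 <= q <= 1 ->
  (1 - q) * binsum m q @[m --> \oo] --> (1 - q) `^ s.
Proof.
move=> /andP[q0]; rewrite le_eqVlt => /predU1P[->|q1].
  by rewrite subrr powR0 ?gt_eqF//; under eq_cvg do rewrite mul0r; exact: cvg_cst.
(* Writing q^m = r^m r^m, one factor absorbs m, since m r^m is at most a geometric sum, and the
   other tends to 0. *)
pose r := Num.sqrt q.
have r0 : 0 <= r by exact: sqrtr_ge0.
have r1 : r < 1 by rewrite -sqrtr1 ltr_sqrt.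
have rq : q = r * r by rewrite -expr2 sqr_sqrtr.
have mr m : m%:R * r ^+ m <= (1 - r)^-1.
  rewrite -[leRHS]div1r ler_pdivlMr ?subr_gt0//.
  apply: (@le_trans _ _ ((\sum_(k < m) r ^+ k) * (1 - r))).
    have -> : m%:R * r ^+ m = \sum_(k < m) r ^+ m.
      by rewrite sumr_const card_ord mulr_natl.
    rewrite ler_wpM2r//; first by rewrite subr_ge0 ltW.
    by apply: ler_sum => k _; apply: ler_wiXn2l => //; [exact: ltW|exact: ltnW].
  by rewrite mulrC -[1 - r]opprB mulNr -subrX1 opprB gerBl exprn_ge0.
rewrite -(cvg_shiftn 1)/=.
apply/cvgrPdist_le => e e0.
have := @cvg_geometric R (1 - r)^-1 r; rewrite ger0_norm// => /(_ r1).
move/cvgrPdist_le => /(_ e e0)[M _ HM].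
exists M => // m /= Mm.
rewrite addn1 distrC (le_trans (binsum_approx _ _)) ?q0//.
have := HM m.+1 (leq_trans Mm (leqnSn _)); rewrite sub0r normrN /geometric/=.
apply: le_trans.
rewrite ger0_norm ?mulr_ge0 ?invr_ge0 ?exprn_ge0 ?subr_ge0 ?(ltW r1)//.
by rewrite rq exprMn mulrA ler_wpM2r// exprn_ge0.
Qed.

End binomial_weights.

Section random_walk.
Context {R : realType} {n : nat}.
Hypothesis n_gt0 : (0 < n)%N.
Implicit Types (f F : 'rV[R]_n -> R) (x y z v : 'rV[R]_n) (nu : 'rV[int]_n).
Implicit Types (s : seq (R * 'rV[int]_n * R)) (h : R).

Let nR : (n%:R : R) != 0. Proof. by rewrite pnatr_eq0 -lt0n. Qed.

Definition avg h F x : R :=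
  (2 * n%:R)^-1 * \sum_(i < n) (F (x + h *: 'e_i) + F (x - h *: 'e_i)).

Definition avgq h nu : R := n%:R^-1 * \sum_(i < n) cos (h * (nu 0 i)%:~R).

Lemma avg_le h f F : (forall x, f x <= F x) -> forall x, avg h f x <= avg h F x.
Proof.
move=> fF x; rewrite ler_wpM2l ?invr_ge0 ?mulr_ge0//.
by apply: ler_sum => i _; rewrite lerD.
Qed.

Lemma avgN h F x : avg h (fun y => - F y) x = - avg h F x.
Proof.
by rewrite /avg -mulrN -sumrN; congr (_ * _); apply: eq_bigr => i _; rewrite opprD.
Qed.

Lemma iter_avgN h F k x : iter k (avg h) (fun y => - F y) x = - iter k (avg h) F x.
Proof.
elim: k x => [//|k IH] x /=; rewrite -avgN; congr (avg h _ x).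
exact/funext.
Qed.

(** First-order terms cancel between the two opposite neighbours, so one step raises the mean
    squared distance to x by exactly h^2. *)
Lemma avg_quad h (u v : R) x y :
  avg h (fun z => u + v * dotv (z - x) (z - x)) y =
  u + v * h ^+ 2 + v * dotv (y - x) (y - x).
Proof.
rewrite /avg (eq_bigr (fun=> 2 * (u + v * h ^+ 2 + v * dotv (y - x) (y - x)))).
  by rewrite sumr_const card_ord -(mulr_natr (2 * _)); field.
move=> i _.
have E (e : R) : dotv (y + e *: 'e_i - x) (y + e *: 'e_i - x) =
    dotv (y - x) (y - x) + 2 * e * (y - x) 0 i + e ^+ 2.
  rewrite addrAC; move: (y - x) => w; rewrite dotvDr !dotvDl !dotvZr !dotv_delta.
  by rewrite (dotvC _ w) dotvZr dotv_delta !mxE !eqxx/=; ring.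
by rewrite E -scaleNr E; ring.
Qed.

(** Comparison principle: averaging preserves inequalities, and by [avg_quad] it maps a paraboloid
    about x to the same paraboloid raised by v h^2. The induction therefore varies F and u while x
    and v stay fixed. *)
Lemma iter_avg_le h (u v : R) F x k :
  (forall y, F y <= u + v * dotv (y - x) (y - x)) ->
  iter k (avg h) F x <= u + k%:R * (v * h ^+ 2).
Proof.
elim: k u F => [|k IH] u F uF.
  by rewrite mul0r addr0 (le_trans (uF x))// subrr dotv0l mulr0 addr0.
rewrite iterSr; apply: (le_trans (IH (u + v * h ^+ 2) (avg h F) _)).
  by move=> y; rewrite -avg_quad; exact: avg_le.
by rewrite -[k.+1%:R]natr1 mulrDl mul1r; lra.
Qed.

Lemma iter_avg_dist h (u v : R) F x k :
  (forall y, `|F y - F x| <= u + v * dotv (y - x) (y - x)) ->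
  `|F x - iter k (avg h) F x| <= u + k%:R * (v * h ^+ 2).
Proof.
move=> uF; rewrite ler_norml; apply/andP; split.
  have := @iter_avg_le h (u + F x) v F x k => /(_ _); set I := iter k _ _ x.
  suff H y : F y <= u + F x + v * dotv (y - x) (y - x) by move=> /(_ H); lra.
  by have := uF y; rewrite ler_norml => /andP[]; lra.
have := @iter_avg_le h (u - F x) v (fun y => - F y) x k.
rewrite iter_avgN; set I := iter k _ _ x.
suff H y : - F y <= u - F x + v * dotv (y - x) (y - x) by move=> /(_ H); lra.
by have := uF y; rewrite ler_norml => /andP[]; lra.
Qed.

Lemma avg_wave h nu c x : avg h (wave nu c) x = avgq h nu * wave nu c x.
Proof.
rewrite /avg /avgq (eq_bigr (fun i => 2 * wave nu c x * cos (h * (nu 0 i)%:~R))).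
  by rewrite -mulr_sumr invfM; field.
move=> i _; rewrite /wave !dotvDr dotvNr dotvZr dotv_delta mxE.
rewrite (addrAC _ (h * _) c) (addrAC _ (- (h * _)) c).
by move: (dotv _ x + c) (h * _) => A B; rewrite cosD cosB; ring.
Qed.

Lemma iter_avg_trig h s k x :
  iter k (avg h) (trig s) x =
  \sum_(p <- s) p.1.1 * avgq h p.1.2 ^+ k * wave p.1.2 p.2 x.
Proof.
elim: k x => [|k IH] x.
  by apply: eq_bigr => p _; rewrite expr0 mulr1.
rewrite iterS {1}/avg; under eq_bigr do rewrite !IH -big_split/=.
rewrite exchange_big mulr_sumr/=; apply: eq_bigr => p _.
under eq_bigr do rewrite -mulrDr.
by rewrite -mulr_sumr mulrCA -[_ * \sum_(i < n) _]/(avg h _ x) avg_wave exprSr; ring.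
Qed.

Lemma avgq_le1 h nu : avgq h nu <= 1.
Proof.
rewrite /avgq mulrC ler_pdivrMr ?ltr0n// mul1r.
have -> : n%:R = \sum_(i < n) 1 :> R by rewrite sumr_const card_ord.
by apply: ler_sum => i _; exact: cos_le1.
Qed.

(** [harmonic K] is 1/(K+1), so the step is (K+1)^(-1/2) and k steps have variance k/(K+1). *)
Definition step K : R := Num.sqrt (harmonic K).

Lemma sqr_step K : step K ^+ 2 = K.+1%:R^-1.
Proof. by rewrite sqr_sqrtr// /harmonic/= invr_ge0. Qed.

Lemma cvg_step : step K @[K --> \oo] --> (0 : R).
Proof.
have := continuous_cvg _ (@sqrt_continuous R 0) cvg_harmonic.
by rewrite sqrtr0; apply.
Qed.

(** By the half-angle formula the expression is the square of a difference quotient of the sine at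
    0, taken along the positive sequence [step K]. *)
Lemma cvg_step_cos (a : R) :
  2 * K.+1%:R * (1 - cos (step K * a)) @[K --> \oo] --> a ^+ 2.
Proof.
have E K : 2 * K.+1%:R * (1 - cos (step K * a)) =
    (2 * ((step K)^-1 * sin (a / 2 * step K))) ^+ 2.
  have c2 (t : R) : 1 - cos (t *+ 2) = 2 * sin t ^+ 2.
    by rewrite cos_mulr2n sin2cos2 mulr2n; ring.
  have -> : step K * a = (a / 2 * step K) *+ 2 by rewrite mulr2n; field.
  by rewrite c2 !exprMn exprVn sqr_step invrK; ring.
under eq_cvg do rewrite E.
have D : is_derive (0 : R) (1 : R) (fun u : R => sin (a / 2 * u)) (a / 2).
  apply: is_derive_eq.
  by rewrite /GRing.scale/= mulr0 cos0 mul1r mulr1.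
have step_gt0 K : 0 < step K by rewrite sqrtr_gt0 /harmonic/= invr_gt0.
have L : ((step K)^-1 * sin (a / 2 * step K)) @[K --> \oo] --> a / 2.
  have [D1 D2] := D.
  have : h^-1 *: (sin (a / 2 * (h *: (1 : R) + 0)) - sin (a / 2 * 0)) @[h --> 0^'] --> a / 2.
    by rewrite -[X in _ --> X]D2; exact: D1.
  move=> H; have F : step K @[K --> \oo] --> (0 : R)^'.
    move=> U /= HU.
    have H1 : \forall K \near \oo, step K != 0 -> U (step K) by exact: cvg_step HU.
    by apply: filterS H1 => K; apply; rewrite gt_eqF.
  have := cvg_comp _ _ F H; apply: cvg_trans; apply: near_eq_cvg.
  near=> K; rewrite /= mulr0 sin0 subr0 /GRing.scale/= mulr1 addr0//.
rewrite (_ : a ^+ 2 = (2 * (a / 2)) ^+ 2); last by field.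
have L2 : 2 * ((step K)^-1 * sin (a / 2 * step K)) @[K --> \oo] --> 2 * (a / 2).
  by apply: cvgM => //; exact: cvg_cst.
apply: (continuous_cvg _ (@exprn_continuous R 2 _) L2).
Unshelve. all: by end_near. Qed.

Lemma cvg_avgq nu : avgq (step K) nu @[K --> \oo] --> (1 : R).
Proof.
have -> : 1 = n%:R^-1 * \sum_(i < n) (1 : R) by rewrite sumr_const card_ord mulVf.
apply: cvgM; first exact: cvg_cst.
apply: (@cvg_sumr R) => i _; rewrite -[X in _ --> X]cos0.
have c0 : step K * (nu 0 i)%:~R @[K --> \oo] --> (0 : R).
  rewrite -[X in _ --> X](mul0r (nu 0 i)%:~R).
  by apply: cvgM; [exact: cvg_step|exact: cvg_cst].
apply: (continuous_cvg _ (@continuous_cos R 0) c0).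
Qed.

Lemma cvg_avgq_dotv nu :
  2 * n%:R * K.+1%:R * (1 - avgq (step K) nu) @[K --> \oo] -->
  (dotv (intvec nu) (intvec nu) : R).
Proof.
have E K : 2 * n%:R * K.+1%:R * (1 - avgq (step K) nu) =
    \sum_(i < n) 2 * K.+1%:R * (1 - cos (step K * (nu 0 i)%:~R)).
  rewrite -mulr_sumr sumrB sumr_const card_ord -[1 *+ n]/(n%:R) /avgq; field.
  exact: nR.
under eq_cvg do rewrite E.
apply: (@cvg_sumr R) => i _; rewrite mxE -expr2.
exact: cvg_step_cos.
Qed.

Lemma continuous_powRl (p a : R) : 0 < a -> {for a, continuous (fun x : R => x `^ p)}.
Proof.
move=> a0; apply/differentiable_continuous/derivable1_diffP.
by apply: derivable_powR; rewrite in_itv/= a0.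
Qed.

Lemma cvg_avgq_powR nu (p : R) : 0 < p ->
  (2 * n%:R * K.+1%:R * (1 - avgq (step K) nu)) `^ p @[K --> \oo] -->
  (dotv (intvec nu) (intvec nu) : R) `^ p.
Proof.
move=> p0.
(* The power function is known to be continuous at positive points only; at frequency 0 the sequence
   is constant. *)
have [d0|d0] := eqVneq (dotv (intvec nu) (intvec nu) : R) 0.
  have nu0 i : nu 0 i = 0.
    move/eqP: d0; rewrite psumr_eq0 => [|j _]; last by rewrite -expr2 sqr_ge0.
    move=> /allP/(_ i); rewrite mem_index_enum => /(_ isT).
    by rewrite mulf_eq0 orbb mxE intr_eq0 => /eqP.
  rewrite d0; rewrite (_ : (fun K => _) = cst (0 `^ p)); first exact: cvg_cst.
  apply/funext => K; rewrite /avgq (eq_bigr (fun=> 1)) => [|i _].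
    by rewrite sumr_const card_ord mulVf// subrr mulr0.
  by rewrite nu0 mulr0 cos0.
have d_gt0 : 0 < dotv (intvec nu) (intvec nu) :> R.
  by rewrite lt0r d0 sumr_ge0// => i _; rewrite -expr2 sqr_ge0.
by have := continuous_cvg _ (continuous_powRl (p := p) d_gt0) (@cvg_avgq_dotv nu); apply.
Qed.

End random_walk.

(** * The bound uniform in sigma for trigonometric polynomials *)

Section fractional_laplacian_bound.
Context {R : realType} {n : nat}.
Hypothesis n_gt0 : (0 < n)%N.
Implicit Types (x y z v : 'rV[R]_n) (nu : 'rV[int]_n).
Implicit Types (l : seq (R * 'rV[int]_n * R)).

Definition trig_lap (sigma : R) l x : R :=
  \sum_(p <- l) p.1.1 * enorm (intvec p.1.2) `^ sigma * wave p.1.2 p.2 x.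

Lemma dotv_ge0 x : 0 <= dotv x x.
Proof. by apply: sumr_ge0 => i _; rewrite -expr2 sqr_ge0. Qed.

Lemma enorm_powR2 x (t : R) : enorm x `^ (2 * t) = dotv x x `^ t.
Proof.
by rewrite /enorm -powR12_sqrt ?dotv_ge0// -powRrM mulrA mulVf ?mul1r.
Qed.

(** With r = tau u this is u^g <= 1 + u. It replaces a Hoelder modulus, a power of the squared
    distance r, by a paraboloid at a scale tau that remains to be chosen. *)
Lemma powR_quad_bound (g tau r : R) : 0 < g < 1 -> 0 < tau -> 0 <= r ->
  r `^ g <= tau `^ g + tau `^ g / tau * r.
Proof.
move=> g01 tau0 r0.
have {1}-> : r = tau * (r / tau) by rewrite mulrC divfK// gt_eqF.
rewrite powRM ?divr_ge0 ?(ltW tau0)//.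
rewrite -mulrA (mulrC _ r) -[X in X + _]mulr1 -mulrDr ler_wpM2l ?powR_ge0//.
apply: (le_trans (powR_bernoulli (divr_ge0 r0 (ltW tau0)) g01)).
rewrite lerD2l; have /andP[g0 g1] := g01.
have : 0 <= r / tau by rewrite divr_ge0// ltW.
move: (r / tau) => u u0.
have : 0 <= (1 - g) * u by apply: mulr_ge0 => //; rewrite subr_ge0 ltW.
by move: g0; lra.
Qed.

(** The factor K^(-s) of [binw_sum_le] cancels the normalization (2 n K)^s that turns 1 - q_h into
    |nu|^2. The estimate thus survives m to infinity at fixed K, and then K to infinity. *)
Lemma trig_lap_bound (s g B C : R) l : 0 < s -> 2 * s <= g -> g < 1 ->
  0 <= B -> 0 <= C -> (forall x, `|trig l x| <= B) ->
  (forall x y, `|trig l x - trig l y| <= C * dotv (x - y) (x - y) `^ g) ->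
  forall x, `|trig_lap (2 * s) l x| <= (2 * n%:R) `^ s * (2 * C + 2 * B).
Proof.
move=> s0 sg g1 B0 C0 lB lC x.
have nR : 0 < n%:R :> R by rewrite ltr0n.
have s01 : 0 < s < 1 by apply/andP; split => //; lra.
have g01 : 0 < g < 1 by apply/andP; split => //; lra.
have walk K k : `|trig l x - iter k (avg (step K)) (trig l) x| <=
    2 * C * (k%:R / K.+1%:R) `^ g.
  case: k => [|k].
    by rewrite subrr normr0 mulr_ge0 ?powR_ge0 ?mulr_ge0.
  (* The scale is the variance of k+1 steps, which makes the constant and the variance term both
     equal to C tau^g. *)
  pose tau : R := k.+1%:R / K.+1%:R.
  have tau0 : 0 < tau by rewrite divr_gt0.
  have := @iter_avg_dist R n n_gt0 (step K) (C * tau `^ g) (C * (tau `^ g / tau))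
    (trig l) x k.+1.
  rewrite sqr_step => H; apply: (le_trans (H _)).
    move=> y; apply: (le_trans (lC y x)).
    by rewrite -mulrA -mulrDr ler_wpM2l// powR_quad_bound// dotv_ge0.
  rewrite -/tau le_eqVlt; apply/orP; left; apply/eqP.
  rewrite (_ : k.+1%:R * _ = C * (tau `^ g / tau) * tau); last by rewrite /tau; ring.
  by rewrite -mulrA divfK ?gt_eqF//; ring.
have walkB K k : `|trig l x - iter k (avg (step K)) (trig l) x| <= 2 * B.
  have := @iter_avg_dist R n n_gt0 (step K) (2 * B) 0 (trig l) x k.
  rewrite mul0r mulr0 addr0; apply => y; rewrite mul0r addr0.
  by rewrite (le_trans (ler_normB _ _))// mulr_natl mulr2n lerD.
have H1 K m : (K.+1 <= m)%N ->
    `|\sum_(p <- l) p.1.1 * ((1 - avgq (step K) p.1.2) * binsum s m (avgq (step K) p.1.2))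
      * wave p.1.2 p.2 x| <= (2 * C + 2 * B) * K.+1%:R `^ (- s).
  move=> Km.
  have := @binw_sum_le R s s01 g (2 * C) (2 * B) K.+1 m
    (fun k => trig l x - iter k (avg (step K)) (trig l) x).
  rewrite Km subrr !mulr_ge0// => /(_ sg g1 isT isT isT erefl (walk K) (walkB K)).
  congr (`|_| <= _).
  under eq_bigr => k _.
    rewrite opprB addrC addrA subrK !iter_avg_trig// -sumrB mulr_sumr.
    over.
  rewrite exchange_big/=; apply: eq_bigr => p _.
  rewrite /binsum mulr_sumr mulr_sumr mulr_suml; apply: eq_bigr => k _.
  by rewrite exprS; ring.
have H2 : \forall K \near \oo,
    `|\sum_(p <- l) p.1.1 * (2 * n%:R * K.+1%:R * (1 - avgq (step K) p.1.2)) `^ s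
      * wave p.1.2 p.2 x| <= (2 * n%:R) `^ s * (2 * C + 2 * B).
  (* [cvg_binsum] asks for a nonnegative multiplier. Each q_h(nu) tends to 1, and only finitely many
     frequencies occur. *)
  have q0 : \forall K \near \oo, forall p, p \in l -> 0 <= avgq (step K) p.1.2 :> R.
    elim: l {lB lC walk walkB H1} => [|p l IH]; first by near=> K.
    near=> K => p'; rewrite inE => /predU1P[->|]; last by move: p'; near: K.
    near: K; apply: (cvgr_ge (1 : R)); first exact: cvg_avgq.
    exact: ltr01.
  near=> K.
  have qK p : p \in l -> 0 <= (avgq (step K) p.1.2 : R) <= 1.
    by move=> pl; rewrite avgq_le1// andbT; move: p pl; near: K.
  have L : `|\sum_(p <- l) p.1.1 * ((1 - avgq (step K) p.1.2) *
        binsum s m (avgq (step K) p.1.2)) * wave p.1.2 p.2 x| @[m --> \oo] -->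
      `|\sum_(p <- l) p.1.1 * (1 - avgq (step K) p.1.2) `^ s * wave p.1.2 p.2 x|.
    apply: cvg_norm; rewrite big_seq.
    under eq_cvg do rewrite big_seq.
    apply: (@cvg_sumr R) => p pl; apply: cvgM; last exact: cvg_cst.
    by apply: cvgM; [exact: cvg_cst|exact: cvg_binsum (qK _ pl)].
  have L1 : `|\sum_(p <- l) p.1.1 * (1 - avgq (step K) p.1.2) `^ s * wave p.1.2 p.2 x|
      <= (2 * C + 2 * B) * K.+1%:R `^ (- s).
    rewrite -(cvg_lim _ L)//; apply: limr_le; first by apply/cvg_ex; eexists; exact: L.
    by exists K.+1 => // m /= Km; exact: H1.
  have -> : \sum_(p <- l) p.1.1 * (2 * n%:R * K.+1%:R * (1 - avgq (step K) p.1.2)) `^ s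
      * wave p.1.2 p.2 x = (2 * n%:R) `^ s * K.+1%:R `^ s *
      \sum_(p <- l) p.1.1 * (1 - avgq (step K) p.1.2) `^ s * wave p.1.2 p.2 x.
    rewrite mulr_sumr; apply: eq_bigr => p _.
    have q1 : 0 <= 1 - avgq (step K) p.1.2 :> R by rewrite subr_ge0 avgq_le1.
    have nK : 0 <= 2 * n%:R * K.+1%:R :> R by rewrite !mulr_ge0.
    have n0 : 0 <= 2 * n%:R :> R by rewrite mulr_ge0.
    by rewrite (powRM s nK q1) (powRM s n0 (ler0n _ K.+1)); ring.
  rewrite normrM ger0_norm ?mulr_ge0 ?powR_ge0// -mulrA ler_wpM2l ?powR_ge0//.
  rewrite mulrC -ler_pdivlMr ?powR_gt0//; by rewrite -powRN.
have L : `|\sum_(p <- l) p.1.1 * (2 * n%:R * K.+1%:R * (1 - avgq (step K) p.1.2)) `^ s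
      * wave p.1.2 p.2 x| @[K --> \oo] --> `|trig_lap (2 * s) l x|.
  apply: cvg_norm; rewrite /trig_lap; under eq_bigr do rewrite enorm_powR2.
  apply: (@cvg_sumr R) => p _; apply: cvgM; last exact: cvg_cst.
  by apply: cvgM; [exact: cvg_cst|exact: cvg_avgq_powR].
rewrite -(cvg_lim _ L)//; apply: limr_le => //.
by apply/cvg_ex; eexists; exact: L.
Unshelve. all: by end_near. Qed.

End fractional_laplacian_bound.

(** * Smooth functions *)

Section smooth_functions.
Context {R : realType} {n : nat}.
Implicit Types (f g phi : 'rV[R]_n -> R) (x y z v : 'rV[R]_n) (nu : 'rV[int]_n).

Lemma smooth_ctorus phi : smooth_torus phi -> ctorus phi.
Proof. by move=> [tp /(_ [::])[]]. Qed.

Lemma smooth_derivable phi x i : smooth_torus phi -> derivable phi x 'e_i.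
Proof. by move=> [_ /(_ [::])[_]]. Qed.

Lemma smooth_partial phi i : smooth_torus phi -> smooth_torus (partial_derivative phi i).
Proof.
move=> sp; split; last by move=> l; exact: (sp.2 (i :: l)).
move=> x nu; rewrite /partial_derivative /derive.
rewrite (_ : (fun h : R => _) =
  (fun h : R => h^-1 *: ((phi \o shift x) (h *: 'e_i) - phi x)))//.
by apply/funext => h /=; rewrite addrA !sp.1.
Qed.

Lemma is_derive_path phi i y (t : R) : smooth_torus phi ->
  is_derive t (1 : R) (fun u : R => phi (u *: 'e_i + y))
    (partial_derivative phi i (t *: 'e_i + y)).
Proof.
move=> sp; have D : derivable phi (t *: 'e_i + y) 'e_i by exact: smooth_derivable.
have E : (fun h : R => h^-1 *: (((fun u : R => phi (u *: 'e_i + y)) \o shift t)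
      (h *: (1 : R)) - phi (t *: 'e_i + y))) =
    (fun h : R => h^-1 *: ((phi \o shift (t *: 'e_i + y)) (h *: 'e_i) -
      phi (t *: 'e_i + y))).
  apply/funext => h /=; congr (_ *: (phi _ - _)).
  by rewrite scalerDl addrA /GRing.scale/= mulr1.
by split; rewrite /derivable /partial_derivative /derive E.
Qed.

(** The mean value theorem gives a point that differs from y in coordinate i only, so a single term
    of [torus_modulus], applied to the derivative, survives, and it is small uniformly in y. *)
Lemma partial_derivative_unif phi i e : smooth_torus phi -> 0 < e ->
  \forall K \near \oo, forall y,
    `|K.+1%:R * (phi (y + K.+1%:R^-1 *: 'e_i) - phi y) -
      partial_derivative phi i y| <= e.
Proof.
move=> sp e0.
have cd := smooth_ctorus (@smooth_partial phi i sp).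
have e2 : 0 < e / 2 by rewrite divr_gt0.
have [C C0 HC] := torus_modulus cd.1 cd.2 e2.
have : \forall t \near (0 : R), 1 - cos t < e / 2 / (C + 1).
  have L : 1 - cos t @[t --> (0 : R)] --> (0 : R).
    rewrite -[X in _ --> X](subrr 1) -[X in _ --> _ - X]cos0.
    by apply: cvgB; [exact: cvg_cst|exact: continuous_cos].
  by apply: (cvgr_lt _ L); rewrite divr_gt0// ltr_wpDl.
move=> /nbhs_ballP[d /= d0 Hd].
near=> K => y.
have h0 : 0 < K.+1%:R^-1 :> R by rewrite invr_gt0.
have hd : K.+1%:R^-1 < d by near: K; exact: near_infty_natSinv_lt (PosNum d0).
have [||c] := @MVT R (fun u : R => phi (u *: 'e_i + y))
  (fun t => partial_derivative phi i (t *: 'e_i + y)) 0 _ h0.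
- by move=> t _; exact: is_derive_path.
- apply: derivable_within_continuous => t _.
  by have [] := @is_derive_path phi i y t sp.
rewrite in_itv/= => /andP[c0 ch]; rewrite subr0 scale0r add0r [_ *: _ + y]addrC => ->.
rewrite mulrCA mulfV// mulr1 (le_trans (HC _ _))//.
rewrite [leRHS]splitr lerD2l (bigD1 i)//= big1 ?addr0 => [|j ji]; last first.
  by rewrite !mxE (negbTE ji) andbF mulr0 add0r subrr cos0 subrr.
rewrite !mxE !eqxx mulr1 addrK.
have : 1 - cos c < e / 2 / (C + 1).
  by apply: Hd; rewrite /ball/= sub0r normrN gtr0_norm// (lt_trans ch).
rewrite ltr_pdivlMr ?ltr_wpDl// => /ltW; apply: le_trans.
by rewrite mulrC ler_wpM2l ?subr_ge0 ?cos_le1// lerDl.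
Unshelve. all: by end_near. Qed.

(** Integration by parts without boundary terms: translation invariance moves the difference
    quotient from phi to the wave, where it is explicit. Its limit is computed once there and once
    from the uniform convergence of the quotients of phi. *)
Lemma torus_mean_partial phi i nu c : smooth_torus phi ->
  torus_mean (fun y => partial_derivative phi i y * wave nu c y) =
  (nu 0 i)%:~R * torus_mean (fun y => phi y * wave nu (c - pi / 2) y).
Proof.
move=> sp; have cp := smooth_ctorus sp.
have cd := smooth_ctorus (@smooth_partial phi i sp).
pose m := (nu 0 i)%:~R : R.
have cw d : ctorus (fun y => phi y * wave nu d y).
  by apply: ctorusM => //; exact: ctorus_wave.
pose a := torus_mean (fun y => phi y * wave nu c y) : R.
pose b := torus_mean (fun y => phi y * wave nu (c - pi / 2) y) : R.
have G h : torus_mean (fun y => phi (y + h *: 'e_i) * wave nu c y) =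
    cos (m * h) * a + sin (m * h) * b.
  rewrite -torus_meanZ// -torus_meanZ// -torus_meanD; [|exact: ctorusZ|exact: ctorusZ].
  rewrite -[RHS](torus_mean_shift (h *: 'e_i)); last first.
    by apply: ctorusD; exact: ctorusZ.
  apply: eq_torus_mean => y.
  rewrite /wave !addrA !cosBpihalf dotvDr dotvZr dotv_delta mxE -/m (mulrC h).
  rewrite (addrAC _ (m * h) c); move: (dotv _ y + c) (m * h) => A B.
  rewrite -{1}[A](addrK B) cosB; ring.
have G0 : torus_mean (fun y => phi y * wave nu c y) = cos (m * 0) * a + sin (m * 0) * b.
  by rewrite mulr0 cos0 sin0 mul1r mul0r addr0.
have cvgD : K.+1%:R * ((cos (m * K.+1%:R^-1) * a + sin (m * K.+1%:R^-1) * b) -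
    (cos (m * 0) * a + sin (m * 0) * b)) @[K --> \oo] --> m * b.
  have D : is_derive (0 : R) (1 : R)
      (fun h : R => cos (m * h) * a + sin (m * h) * b) (m * b).
    apply: is_derive_eq.
    rewrite /GRing.scale/= !mulr0 ?sin0 ?cos0 ?oppr0 ?mul0r ?mulr0.
    rewrite ?mulr1 ?mul1r ?addr0 ?add0r.
    by rewrite ?mulr0 ?add0r ?addr0 mulrC.
  have [D1 D2] := D.
  have H : h^-1 *: ((cos (m * (h *: (1 : R) + 0)) * a + sin (m * (h *: (1 : R) + 0)) * b)
      - (cos (m * 0) * a + sin (m * 0) * b)) @[h --> 0^'] --> m * b.
    by rewrite -[X in _ --> X]D2; exact: D1.
  have F : K.+1%:R^-1 @[K --> \oo] --> (0 : R)^'.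
    move=> U /= HU.
    have H1 : \forall K \near \oo, K.+1%:R^-1 != 0 :> R -> U (K.+1%:R^-1).
      exact: cvg_harmonic HU.
    by apply: filterS H1 => K; apply; rewrite invr_eq0.
  have := cvg_comp _ _ F H; apply: cvg_trans; apply: near_eq_cvg.
  near=> K; by rewrite /= /GRing.scale/= mulr1 addr0 invrK.
have cvgT : K.+1%:R * ((cos (m * K.+1%:R^-1) * a + sin (m * K.+1%:R^-1) * b) -
    (cos (m * 0) * a + sin (m * 0) * b)) @[K --> \oo] -->
    torus_mean (fun y => partial_derivative phi i y * wave nu c y).
  apply/cvgrPdist_le => e e0.
  have := @partial_derivative_unif phi i e sp e0; apply: filterS => K HK.
  have c1 : ctorus (fun y => phi (y + K.+1%:R^-1 *: 'e_i) * wave nu c y).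
    by apply: ctorusM; [exact: ctorus_shift|exact: ctorus_wave].
  have c2 : ctorus (fun y => partial_derivative phi i y * wave nu c y).
    by apply: ctorusM => //; exact: ctorus_wave.
  rewrite -G -G0 -torus_meanB// -torus_meanZ; last exact: ctorusB.
  rewrite -torus_meanB//; last by apply: ctorusZ; exact: ctorusB.
  apply: norm_torus_mean_le.
    by apply: ctorusB => //; apply: ctorusZ; exact: ctorusB.
  move=> y; rewrite -mulrBl mulrA -mulrBl normrM -[e]mulr1 distrC ler_pM//.
  exact: wave_le1.
exact: (cvg_unique _ cvgT cvgD).
Unshelve. all: by end_near. Qed.

Lemma smooth_decay_seq phi (l : seq 'I_n) M : smooth_torus phi ->
  (forall x, `|foldl partial_derivative phi l x| <= M) ->
  forall nu c, (\prod_(j <- l) `|(nu 0 j)%:~R|) *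
    `|torus_mean (fun y => phi y * wave nu c y)| <= M.
Proof.
elim: l phi => [|j l IH] phi sp pM nu c.
  rewrite big_nil mul1r; apply: norm_torus_mean_le.
    by apply: ctorusM; [exact: smooth_ctorus|exact: ctorus_wave].
  move=> x; rewrite normrM -[M]mulr1 ler_pM//; exact: wave_le1.
(* Integration by parts lowers the phase by pi/2, so the induction hypothesis is taken at the phase
   that returns c. *)
have := IH _ (smooth_partial j sp) pM nu (c + pi / 2).
rewrite torus_mean_partial// addrK normrM big_cons; apply: le_trans.
by rewrite le_eqVlt; apply/orP; left; apply/eqP; ring.
Qed.

Definition freq_weight (m : int) : R := Num.max 1 `|m%:~R|.

Lemma freq_weight_ge1 m : 1 <= freq_weight m.
Proof. by rewrite le_max lexx. Qed.

Lemma freq_weight_gt0 m : 0 < freq_weight m.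
Proof. exact: lt_le_trans (freq_weight_ge1 m). Qed.

(* The product of the weights of the nonzero coordinates of [nu] is the absolute
   value of a monomial in [nu], hence comes from iterated derivatives. *)
Lemma smooth_decay phi : smooth_torus phi -> exists2 M, 0 <= M &
  forall nu c, `|torus_mean (fun y => phi y * wave nu c y)| <=
    M * (\prod_(j < n) freq_weight (nu 0 j)) ^- 4.
Proof.
move=> sp.
(* Four derivatives per coordinate: two powers of the weight will pay for |nu|^sigma, and two are
   left for summability. *)
pose S (J : {set 'I_n}) := flatten [seq nseq 4 j | j <- enum J].
have HM J : exists M, 0 <= M /\
    forall x, `|foldl partial_derivative phi (S J) x| <= M.
  have cJ : ctorus (foldl partial_derivative phi (S J)).
    move: (S J) => l; elim: l phi sp => [|j l IH] psi spsi; first exact: smooth_ctorus.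
    by apply: IH; exact: smooth_partial.
  by have [M M0 HM] := ctorus_bounded cJ; exists M.
pose M J := projT1 (cid (HM J)).
have M0 J : 0 <= M J by rewrite /M; case: (cid _) => ? [].
have MP J x : `|foldl partial_derivative phi (S J) x| <= M J.
  by rewrite /M; case: (cid _) => ? [].
(* The set J of nonzero coordinates depends on nu; summing over all J gives one constant. *)
exists (\sum_J M J) => [|nu c]; first exact: sumr_ge0.
have w0 : 0 < \prod_(j < n) freq_weight (nu 0 j).
  by apply: prodr_gt0 => j _; exact: freq_weight_gt0.
rewrite ler_pdivlMr ?exprn_gt0//.
pose J : {set 'I_n} := finset (fun j => nu 0 j != 0).
apply: (@le_trans _ _ (M J)); last by rewrite (bigD1 J)//= lerDl sumr_ge0.
apply: le_trans (smooth_decay_seq sp (MP J) nu c).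
rewrite mulrC ler_wpM2r// big_flatten/= big_map -prodrXl.
rewrite [leRHS](_ : _ = \prod_(j in J) `|(nu 0 j)%:~R| ^+ 4); last first.
  rewrite -[RHS]big_enum/=; apply: eq_bigr => j _.
  by rewrite !big_cons big_nil mulr1 !exprS expr0 mulr1.
rewrite [leRHS]big_mkcond/=; apply: ler_prod => j _.
rewrite exprn_ge0 ?(ltW (freq_weight_gt0 _))//= inE.
case: eqVneq => [->|j0]/=; first by rewrite /freq_weight normr0 max_l// expr1n.
rewrite /freq_weight max_r// -intr_norm ler1z.
by rewrite -gtz0_ge1 normr_gt0.
Qed.

End smooth_functions.

#[local] Existing Instance totally_filter.

(** * Unconditional sums with a summable majorant *)

Section unconditional_sums.
Context {R : realType} (I : choiceType).
Implicit Types (a u : I -> R) (J : {fset I}).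

Lemma partial_sumE u J : partial_sum u J = \sum_(i <- J) u i.
Proof. by rewrite /partial_sum big_seq_fsetE. Qed.

Lemma partial_sum_sub u J J' : (J `<=` J')%fset ->
  partial_sum u J' = partial_sum u J + \sum_(i <- J' | i \notin J) u i.
Proof.
move=> JJ'; rewrite !partial_sumE (bigID (fun i => i \in J))/=; congr (_ + _).
rewrite -big_filter; apply: perm_big; apply: uniq_perm.
- by rewrite filter_uniq// fset_uniq.
- exact: fset_uniq.
move=> i; rewrite mem_filter; case: (boolP (i \in J)) => //= iJ.
by rewrite (fsubsetP JJ').
Qed.

Lemma partial_sum_tail a (B e : R) : (forall i, 0 <= a i) ->
  (forall J, partial_sum a J <= B) -> 0 < e ->
  exists J0, forall J, (J0 `<=` J)%fset -> partial_sum a J <= partial_sum a J0 + e.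
Proof.
move=> a0 aB e0; pose E := range (partial_sum a).
have supE : has_sup E.
  split; first by exists (partial_sum a fset0), fset0.
  by exists B => _ [J _ <-].
have [_ [J0 _ <-] HJ0] := sup_adherent e0 supE.
exists J0 => J _; rewrite -lerBlDr (le_trans _ (ltW HJ0))// lerD2r.
by apply: ub_le_sup; [case: supE|exists J].
Qed.

(** The finite set J0 is tied to the majorant a alone, so the same set serves a whole family of u;
    this makes the approximation of [fraclap_smooth] uniform in x. *)
Lemma sum_approx a u (B e : R) J0 : (forall i, `|u i| <= a i) ->
  (forall J, partial_sum a J <= B) -> 0 < e ->
  (forall J, (J0 `<=` J)%fset -> partial_sum a J <= partial_sum a J0 + e) ->
  forall J, (J0 `<=` J)%fset -> `|summability.sum (u : I -> R^o) - partial_sum u J| <= e.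
Proof.
move=> ua aB e0 HJ0.
have a0 i : 0 <= a i by rewrite (le_trans _ (ua i)).
have dist (d : R) K :
    (forall J, (K `<=` J)%fset -> partial_sum a J <= partial_sum a K + d) ->
    forall J J', (K `<=` J)%fset -> (J `<=` J')%fset ->
    `|partial_sum u J' - partial_sum u J| <= d.
  move=> HK J J' KJ JJ'; rewrite (partial_sum_sub u JJ') addrC addKr.
  have := HK J' (fsubset_trans KJ JJ').
  rewrite (partial_sum_sub a JJ') (partial_sum_sub a KJ).
  rewrite -addrA lerD2l => /(le_trans _); apply.
  apply: (@le_trans _ _ (\sum_(i <- J' | i \notin J) a i)).
    by rewrite (le_trans (ler_norm_sum _ _ _))// ler_sum.
  by rewrite lerDr sumr_ge0.
have cu : cvg (partial_sum u @ totally).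
  apply: cauchy_cvg.
  suff : cauchy_ex (partial_sum u @ totally) by exact: cauchy_exP.
  move=> d /= d0.
  have [K HK] := partial_sum_tail a0 aB (divr_gt0 d0 (ltr0n R 2)).
  exists (partial_sum u K); exists K => // J /= KJ.
  rewrite /ball/= distrC (le_lt_trans (dist _ _ HK K J (fsubset_refl _) KJ))//.
  by rewrite ltr_pdivrMr// ltr_pMr// ltr1n.
move=> J J0J.
have L : `|partial_sum u J' - partial_sum u J| @[J' --> totally] -->
    `|summability.sum (u : I -> R^o) - partial_sum u J|.
  by apply: cvg_norm; apply: cvgB; [exact: cu|exact: cvg_cst].
rewrite -(cvg_lim _ L)//; apply: limr_le; first by apply/cvg_ex; eexists; exact: L.
by exists J => // J' /= JJ'; exact: (dist _ _ HJ0).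
Qed.

End unconditional_sums.

(** * Summability over the integer lattice *)

Section lattice_sums.
Context {R : realType} {n : nat}.
Implicit Types (x y : 'rV[R]_n) (nu : 'rV[int]_n).

(** Telescoping, by 1/(N+2)^2 <= 1/(N+1) - 1/(N+2). The indices 0 and 1 contribute 1 each, whence 3
    - 1 at the start. *)
Lemma sum_freq_weight N : \sum_(j < N.+2) (freq_weight j%:Z : R) ^- 2 <= 3 - N.+1%:R^-1.
Proof.
elim: N => [|N IH].
  rewrite !big_ord_recr big_ord0/= /freq_weight normr0 normr1 maxxx max_l//.
  by rewrite expr1n invr1; lra.
rewrite big_ord_recr/=.
have -> : freq_weight N.+2%:Z = N.+2%:R :> R.
  rewrite /freq_weight max_r ?ger0_norm//.
  by rewrite -[N.+2%:Z%:~R]/(N.+2%:R) ler1n.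
have : (N.+2%:R : R) ^- 2 <= N.+1%:R^-1 - N.+2%:R^-1.
  have -> : N.+1%:R^-1 - N.+2%:R^-1 = (N.+1%:R * N.+2%:R)^-1 :> R.
    rewrite -[N.+2%:R]natr1; field.
    by rewrite nat1r natr1 !pnatr_eq0.
  rewrite lef_pV2 ?posrE ?exprn_gt0 ?mulr_gt0// expr2 ler_pM2r// ler_nat//.
move: IH; move: (\sum_(_ < _) _) (N.+2%:R ^- 2) N.+1%:R^-1 N.+2%:R^-1 => a b c d; lra.
Qed.

Definition lattice_weight nu : R := (\prod_(j < n) freq_weight (nu 0 j)) ^- 2.

Lemma lattice_weight_ge0 nu : 0 <= lattice_weight nu.
Proof.
rewrite invr_ge0 exprn_ge0// prodr_ge0// => j _; exact/ltW/freq_weight_gt0.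
Qed.

(** Every finite J lies in a cube, over which the sum is a product of n one-dimensional sums; each
    is at most 6, namely 3 for either sign. *)
Lemma lattice_weight_sum (J : {fset 'rV[int]_n}) :
  partial_sum lattice_weight J <= 6 ^+ n.
Proof.
have [N HN] : exists N : nat, forall nu, nu \in J -> forall j, (`|nu 0%R j| <= N)%N.
  exists (\max_(nu <- J) \max_(j < n) `|nu 0%R j|%N) => nu nuJ j.
  apply: (@leq_trans (\max_(j < n) `|nu 0%R j|%N)).
    exact: (leq_bigmax j).
  by rewrite (big_rem nu)//= leq_maxl.
(* Coordinates are coded by sign and absolute value. Zero is coded twice, which is harmless for an
   upper bound. *)
pose K := {ffun 'I_n -> bool * 'I_N.+2}.
pose G (k : bool * 'I_N.+2) : int := if k.1 then - (k.2 : nat)%:Z else (k.2 : nat)%:Z.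
pose g (k : K) : 'rV[int]_n := \row_j G (k j).
have Hg nu : nu \in J -> exists k, g k = nu.
  move=> nuJ; exists [ffun j => (nu 0 j < 0, inord `|nu 0%R j|%N)].
  apply/rowP => j; rewrite !mxE ffunE /G/= inordK; last first.
    by rewrite ltnS (leq_trans (HN _ nuJ j)).
  by rewrite abszE; case: ltrP => h; [rewrite ltr0_norm ?opprK|rewrite ger0_norm].
rewrite partial_sumE.
apply: (@le_trans _ _ (\sum_(nu <- J) \sum_(k : K) (g k == nu)%:R * lattice_weight nu)).
  rewrite big_seq [leRHS]big_seq; apply: ler_sum => nu /Hg[k gk].
  rewrite (bigD1 k)//= gk eqxx mul1r lerDl sumr_ge0// => k' _.
  by rewrite mulr_ge0// lattice_weight_ge0.
rewrite exchange_big/=.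
apply: (@le_trans _ _ (\sum_(k : K) lattice_weight (g k))).
  apply: ler_sum => k _.
  have [gJ|gJ] := boolP (g k \in J); last first.
    rewrite big_seq big1 ?lattice_weight_ge0// => nu nuJ.
    by case: eqP => [E|]; rewrite ?mul0r//; rewrite E nuJ in gJ.
  rewrite (big_rem (g k))//= eqxx mul1r big_seq big1 ?addr0// => nu.
  rewrite mem_rem_uniq ?fset_uniq// inE => /andP[/negbTE nuk _].
  by rewrite eq_sym nuk mul0r.
rewrite /lattice_weight.
under eq_bigr => k _.
  rewrite -prodrXl -prodfV; under eq_bigr do rewrite mxE.
  over.
rewrite -(bigA_distr_bigA (fun _ m => (freq_weight (G m) ^+ 2)^-1))/= prodr_const card_ord.
rewrite lerXn2r ?nnegrE//.
  by apply: sumr_ge0 => k _; rewrite invr_ge0 sqr_ge0.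
rewrite -(pair_bigA _ (fun b j => (freq_weight (G (b, j)) ^+ 2)^-1))/= big_bool/=.
have E : \sum_(j < N.+2) (freq_weight (- (j : nat)%:Z) ^+ 2)^-1 =
    \sum_(j < N.+2) (freq_weight (j : nat)%:Z ^+ 2)^-1 :> R.
  by apply: eq_bigr => j _; rewrite /freq_weight mulrNz normrN.
rewrite /G/= E; have := sum_freq_weight N.
have : 0 <= N.+1%:R^-1 :> R by rewrite invr_ge0.
move=> a0 H; rewrite (le_trans (lerD H H))//.
by move: a0; move: N.+1%:R^-1 => a a0; lra.
Qed.

End lattice_sums.

(** * The fractional Laplacian of smooth functions and its duality *)

Section fractional_laplacian_smooth.
Context {R : realType} {n : nat}.
Hypothesis n_gt0 : (0 < n)%N.
Implicit Types (f g phi : 'rV[R]_n -> R) (x y z v : 'rV[R]_n) (nu : 'rV[int]_n).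
Implicit Types (l : seq (R * 'rV[int]_n * R)).

Definition fraclap_term (sigma : R) phi x nu : R :=
  enorm (intvec nu) `^ sigma *
  torus_mean (fun y => phi y * cos (dotv (intvec nu) (x - y))).

Lemma fraclap_smoothE (sigma : R) phi x : ctorus phi ->
  fraclap_smooth sigma phi x = summability.sum (fraclap_term sigma phi x : _ -> R^o).
Proof.
move=> cp; rewrite /fraclap_smooth; congr summability.sum; apply/funext => nu.
rewrite /fraclap_term torus_mean_conv_wave// /fourier_coef /cis.
rewrite (_ : torus_mean (fun y => complex.Re _) = torus_mean (fun y => phi y * wave nu 0 y)).
  rewrite (_ : torus_mean (fun y => complex.Im _) =
      - torus_mean (fun y => phi y * wave nu (- (pi / 2)) y)); last first.
    rewrite -torus_meanN; last by apply: ctorusM => //; exact: ctorus_wave.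
    apply: eq_torus_mean => y /=.
    by rewrite mul0r addr0 sinN /wave cosBpihalf mulrN.
  rewrite /= /wave !addr0 cosBpihalf; ring.
apply: eq_torus_mean => y /=.
by rewrite mul0r subr0 cosN /wave addr0.
Qed.

(** The right side bounds both 1 and |nu|^2, hence also |nu|^2 raised to the power sigma/2, which is
    at most 1. *)
Lemma enorm_powR_le (sigma : R) nu : 0 < sigma <= 2 ->
  enorm (intvec nu : 'rV[R]_n) `^ sigma <=
  n%:R * (\prod_(j < n) freq_weight (nu 0 j)) ^+ 2.
Proof.
move=> /andP[s0 s2]; set W := \prod_(j < n) _.
have W1 (P : pred 'I_n) : 1 <= \prod_(j < n | P j) freq_weight (nu 0 j) :> R.
  apply: (@le_trans _ _ (\prod_(j < n | P j) (1 : R))); first by rewrite big1.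
  apply: ler_prod => j _; rewrite ler01; exact: freq_weight_ge1.
have D1 : 1 <= n%:R * W ^+ 2.
  rewrite -[leLHS]mulr1 ler_pM// ?ler1n//.
  by rewrite expr_ge1 ?(le_trans ler01)// W1.
have dD : dotv (intvec nu) (intvec nu) <= n%:R * W ^+ 2.
  have -> : n%:R * W ^+ 2 = \sum_(i < n) W ^+ 2 by rewrite sumr_const card_ord mulr_natl.
  apply: ler_sum => i _; rewrite !mxE -expr2.
  apply: (@le_trans _ _ (`|(nu 0 i)%:~R| ^+ 2)); first by rewrite real_normK ?num_real.
  rewrite lerXn2r ?nnegrE ?(le_trans ler01 (W1 _))//.
  rewrite /W (bigD1 i)//=; apply: (@le_trans _ _ (freq_weight (nu 0 i))).
    by rewrite le_max lexx orbT.
  by rewrite ler_peMr ?W1// ltW ?freq_weight_gt0.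
have -> : sigma = 2 * (sigma / 2) by field.
rewrite enorm_powR2; apply: (@le_trans _ _ ((n%:R * W ^+ 2) `^ (sigma / 2))).
  by rewrite ge0_ler_powR ?nnegrE ?dotv_ge0 ?(le_trans ler01 D1)// divr_ge0// ltW.
rewrite -[leRHS]powRr1 ?(le_trans ler01 D1)//.
by apply: ler_powR => //; rewrite ler_pdivrMr// mul1r.
Qed.

(** Growth W^2 of the multiplier against decay W^(-4) of the coefficients leaves W^(-2), with a
    constant independent of sigma and x. *)
Lemma fraclap_term_le phi : smooth_torus phi -> exists2 B, 0 <= B &
  forall (sigma : R), 0 < sigma <= 2 -> forall x nu,
    `|fraclap_term sigma phi x nu| <= B * lattice_weight nu.
Proof.
move=> sp; have [M M0 HM] := smooth_decay sp.
exists (n%:R * M) => [|sigma s02 x nu]; first by rewrite mulr_ge0.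
rewrite normrM ger0_norm ?powR_ge0//.
have := HM (- nu) (dotv (intvec nu) x).
rewrite (_ : \prod_(j < n) _ = \prod_(j < n) freq_weight (nu 0 j)); last first.
  by apply: eq_bigr => j _; rewrite mxE /freq_weight mulrNz normrN.
rewrite (eq_torus_mean (g := fun y => phi y * cos (dotv (intvec nu) (x - y)))); last first.
  by move=> y; rewrite wave_diff.
move=> H; have := ler_pM (powR_ge0 _ _) (normr_ge0 _) (enorm_powR_le nu s02) H.
move=> /le_trans; apply; rewrite /lattice_weight.
set W := \prod_(j < n) _.
have W0 : 0 < W by apply: prodr_gt0 => j _; exact: freq_weight_gt0.
rewrite le_eqVlt; apply/orP; left; apply/eqP; field.
by rewrite gt_eqF.
Qed.

Lemma fraclap_smooth_approx phi (sigma e : R) :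
  smooth_torus phi -> 0 < sigma <= 2 -> 0 < e ->
  exists J0 : {fset 'rV[int]_n}, forall J, (J0 `<=` J)%fset -> forall x,
    `|fraclap_smooth sigma phi x - \sum_(nu <- J) fraclap_term sigma phi x nu| <= e.
Proof.
move=> sp s02 e0; have [B B0 HB] := fraclap_term_le sp.
pose a nu := B * lattice_weight nu : R.
have aB J : partial_sum a J <= B * 6 ^+ n.
  rewrite partial_sumE -mulr_sumr ler_wpM2l// -partial_sumE.
  exact: lattice_weight_sum.
have a0 nu : 0 <= a nu by rewrite mulr_ge0// lattice_weight_ge0.
have [J0 HJ0] := partial_sum_tail a0 aB e0.
exists J0 => J J0J x; rewrite fraclap_smoothE; last exact: smooth_ctorus.
rewrite -partial_sumE; apply: (@sum_approx _ _ a _ _ _ J0) => // nu.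
exact: HB.
Qed.

Lemma ctorus_conv_wave phi nu : ctorus phi ->
  ctorus (fun x => torus_mean (fun y => phi y * cos (dotv (intvec nu) (x - y)))).
Proof.
move=> cp; under [X in ctorus X]funext do rewrite torus_mean_conv_wave//.
by apply: ctorusD; apply: ctorusZ; exact: ctorus_wave.
Qed.

Lemma ctorus_unif f : (forall e : R, 0 < e -> exists2 g, ctorus g &
  forall x, `|f x - g x| <= e) -> ctorus f.
Proof.
move=> fg; split=> [x nu|x].
  apply/eqP; rewrite -subr_eq0 -normr_le0; apply/ler_addgt0Pr => e e0.
  rewrite add0r; have [g cg Hg] := fg _ (divr_gt0 e0 (ltr0n R 2)).
  have -> : f (x + (2 * pi) *: intvec nu) - f x =
    (f (x + (2 * pi) *: intvec nu) - g (x + (2 * pi) *: intvec nu)) - (f x - g x).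
    by rewrite cg.1; ring.
  by rewrite [leRHS]splitr (le_trans (ler_normB _ _))// lerD.
apply: (iffRL (@cvgrPdist_le _ _ _ (nbhs x) _ f (f x))) => e e0.
have [g cg Hg] := fg _ (divr_gt0 e0 (ltr0n R 3)).
have H : \forall y \near x, `|g x - g y| <= e / 3.
  exact: (iffLR (@cvgrPdist_le _ _ _ (nbhs x) _ g (g x)) (cg.2 x) _
    (divr_gt0 e0 (ltr0n R 3))).
near=> y.
have Hy : `|g x - g y| <= e / 3 by near: y; exact: H.
have -> : f x - f y = (f x - g x) + (g x - g y) - (f y - g y) by ring.
rewrite (le_trans (ler_normB _ _))//.
have := lerD (lerD (Hg x) Hy) (Hg y).
rewrite (_ : e / 3 + e / 3 + e / 3 = e); last by field.
apply: le_trans; rewrite lerD2r; exact: ler_normD.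
Unshelve. all: by end_near. Qed.

Lemma ctorus_fraclap_term (sigma : R) phi nu : ctorus phi ->
  ctorus (fun x => fraclap_term sigma phi x nu).
Proof. by move=> cp; apply: ctorusZ; exact: ctorus_conv_wave. Qed.

Lemma ctorus_fraclap_smooth (sigma : R) phi : smooth_torus phi -> 0 < sigma <= 2 ->
  ctorus (fraclap_smooth sigma phi).
Proof.
move=> sp s02; apply: ctorus_unif => e e0.
have [J0 HJ0] := fraclap_smooth_approx sp s02 e0.
exists (fun x => \sum_(nu <- J0) fraclap_term sigma phi x nu).
  by apply: ctorus_sum => nu _; apply: ctorus_fraclap_term; exact: smooth_ctorus.
exact/HJ0/fsubset_refl.
Qed.

(** A real wave carries the frequencies mu and - mu, each with weight 1/2. At mu = 0 both indicators
    hold and the weights add up to 1. *)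
Lemma wave_pairing phi mu nu c : ctorus phi ->
  torus_mean (fun x => wave mu c x *
    torus_mean (fun y => phi y * cos (dotv (intvec nu) (x - y)))) =
  2^-1 * ((nu == - mu)%:R + (nu == mu)%:R) *
    torus_mean (fun y => phi y * wave mu c y).
Proof.
move=> cp.
pose A (k : 'rV[int]_n) := torus_mean (fun y => phi y * wave k 0 y) : R.
pose B (k : 'rV[int]_n) := torus_mean (fun y => phi y * wave k (- (pi / 2)) y) : R.
have cpw k d : ctorus (fun y => phi y * wave k d y).
  by apply: ctorusM => //; exact: ctorus_wave.
have ww d : torus_mean (fun x => wave mu c x * wave nu d x) =
    2^-1 * ((nu == - mu)%:R * cos (c + d) + (nu == mu)%:R * cos (c - d)).
  have E x : wave mu c x * wave nu d x =
      2^-1 * (wave (mu + nu) (c + d) x + wave (mu - nu) (c - d) x).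
    rewrite /wave !intvecD intvecN !dotvDl dotvNl.
    have -> : dotv (intvec mu) x + dotv (intvec nu) x + (c + d) =
      (dotv (intvec mu) x + c) + (dotv (intvec nu) x + d) by ring.
    have -> : dotv (intvec mu) x - dotv (intvec nu) x + (c - d) =
      (dotv (intvec mu) x + c) - (dotv (intvec nu) x + d) by ring.
    move: (dotv (intvec mu) x + c) (dotv (intvec nu) x + d) => u w.
    by rewrite cosD cosB; field.
  rewrite (eq_torus_mean E) torus_meanZ; last by apply: ctorusD; exact: ctorus_wave.
  rewrite torus_meanD; [|exact: ctorus_wave|exact: ctorus_wave].
  rewrite !torus_mean_wave subr_eq0 (eq_sym mu nu).
  by rewrite (addrC mu nu) addr_eq0.
have E1 k : torus_mean (fun y => phi y * wave k c y) = A k * cos c - B k * sin c.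
  rewrite /A /B mulrC -torus_meanZ// [X in _ - X]mulrC -torus_meanZ//.
  rewrite -torus_meanB; [|exact: ctorusZ|exact: ctorusZ].
  apply: eq_torus_mean => y; rewrite /wave !addr0 cosBpihalf cosD; ring.
have AN : A (- mu) = A mu.
  by apply: eq_torus_mean => y; rewrite /wave intvecN dotvNl !addr0 cosN.
have BN : B (- mu) = - B mu.
  rewrite -torus_meanN//; apply: eq_torus_mean => y.
  by rewrite /wave intvecN dotvNl !cosBpihalf sinN mulrN.
have E2 x : wave mu c x * torus_mean (fun y => phi y * cos (dotv (intvec nu) (x - y))) =
    A nu * (wave mu c x * wave nu 0 x) +
    B nu * (wave mu c x * wave nu (- (pi / 2)) x).
  by rewrite torus_mean_conv_wave// /A /B; ring.
have cww d : ctorus (fun x => wave mu c x * wave nu d x : R).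
  by apply: ctorusM; exact: ctorus_wave.
rewrite (eq_torus_mean E2) torus_meanD; [|exact: ctorusZ|exact: ctorusZ].
rewrite !torus_meanZ// !ww E1 addr0 subr0 opprK cosBpihalf cosDpihalf.
have d1A : (nu == - mu)%:R * A nu = (nu == - mu)%:R * A mu.
  by case: eqP => [->|]; rewrite ?mul0r// AN.
have d2A : (nu == mu)%:R * A nu = (nu == mu)%:R * A mu.
  by case: eqP => [->|]; rewrite ?mul0r.
have d1B : (nu == - mu)%:R * B nu = - ((nu == - mu)%:R * B mu).
  by case: eqP => [->|]; rewrite ?mul0r ?oppr0// BN mulrN.
have d2B : (nu == mu)%:R * B nu = (nu == mu)%:R * B mu.
  by case: eqP => [->|]; rewrite ?mul0r.
transitivity (2^-1 * (((nu == - mu)%:R * A nu + (nu == mu)%:R * A nu) * cos c +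
  ((nu == - mu)%:R * B nu - (nu == mu)%:R * B nu) * sin c)); first by ring.
by rewrite d1A d2A d1B d2B; ring.
Qed.

Lemma ctorus_trig_lap (sigma : R) l : ctorus (trig_lap sigma l : 'rV[R]_n -> R).
Proof.
apply: ctorus_sum => p _; apply: ctorusZ; exact: ctorus_wave.
Qed.

Lemma trig_lap_cat (sigma : R) l1 l2 x :
  trig_lap sigma (l1 ++ l2) x = trig_lap sigma l1 x + trig_lap sigma l2 x :> R.
Proof. exact: big_cat. Qed.

Lemma enormN nu : enorm (intvec (- nu)) = enorm (intvec nu) :> R.
Proof. by rewrite /enorm intvecN dotvNl dotvNr opprK. Qed.

(** J contains each frequency of l together with its opposite, so the two halves given by
    [wave_pairing] are both present, and the norm takes the same value on them. *)
Lemma trig_partial_dual l phi (sigma : R) (J : {fset 'rV[int]_n}) : ctorus phi ->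
  (forall p, p \in l -> p.1.2 \in J /\ - p.1.2 \in J) ->
  torus_mean (fun x => trig l x * \sum_(nu <- J) fraclap_term sigma phi x nu) =
  torus_mean (fun x => trig_lap sigma l x * phi x).
Proof.
move=> cp lJ.
have ct nu := ctorus_fraclap_term sigma nu cp.
have cS : ctorus (fun x => \sum_(nu <- J) fraclap_term sigma phi x nu).
  by apply: ctorus_sum => nu _; exact: ct.
transitivity (\sum_(p <- l) torus_mean (fun x =>
    p.1.1 * (wave p.1.2 p.2 x * \sum_(nu <- J) fraclap_term sigma phi x nu))).
  rewrite -torus_mean_sum => [|p _].
    apply: eq_torus_mean => x; rewrite /trig mulr_suml.
    by apply: eq_bigr => p _; rewrite mulrA.
  by apply: ctorusZ; apply: ctorusM => //; exact: ctorus_wave.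
transitivity (\sum_(p <- l) torus_mean (fun x =>
    p.1.1 * enorm (intvec p.1.2) `^ sigma * (wave p.1.2 p.2 x * phi x))); last first.
  rewrite -torus_mean_sum => [|p _].
    apply: eq_torus_mean => x; rewrite /trig_lap mulr_suml.
    by apply: eq_bigr => p _; rewrite !mulrA.
  by apply: ctorusZ; apply: ctorusM => //; exact: ctorus_wave.
rewrite big_seq [RHS]big_seq; apply: eq_bigr => p /lJ[pJ pNJ].
rewrite !torus_meanZ; last 2 first.
- by apply: ctorusM => //; exact: ctorus_wave.
- by apply: ctorusM => //; exact: ctorus_wave.
rewrite -mulrA; congr (_ * _).
rewrite (eq_torus_mean (g := fun x => \sum_(nu <- J) enorm (intvec nu) `^ sigma *
  (wave p.1.2 p.2 x * torus_mean (fun y => phi y * cos (dotv (intvec nu) (x - y)))))); last first.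
  move=> x; rewrite mulr_sumr; apply: eq_bigr => nu _.
  by rewrite /fraclap_term mulrCA.
have cc nu : ctorus (fun x => wave p.1.2 p.2 x *
    torus_mean (fun y => phi y * cos (dotv (intvec nu) (x - y)))).
  by apply: ctorusM; [exact: ctorus_wave|exact: ctorus_conv_wave].
rewrite torus_mean_sum => [|nu _]; last exact: ctorusZ.
under eq_bigr do rewrite torus_meanZ// wave_pairing//.
pose E := torus_mean (fun y => phi y * wave p.1.2 p.2 y) : R.
rewrite [in RHS](eq_torus_mean (g := fun y => phi y * wave p.1.2 p.2 y)); last first.
  by move=> y; rewrite mulrC.
rewrite -/E.
transitivity (2^-1 * E * (\sum_(nu <- J) enorm (intvec nu) `^ sigma * (nu == - p.1.2)%:R +
   \sum_(nu <- J) enorm (intvec nu) `^ sigma * (nu == p.1.2)%:R)).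
  rewrite -big_split/= mulr_sumr; apply: eq_bigr => nu _; ring.
have D k : k \in J -> \sum_(nu <- J) enorm (intvec nu) `^ sigma * (nu == k)%:R =
    enorm (intvec k) `^ sigma :> R.
  move=> kJ; rewrite (big_rem k)//= eqxx mulr1 big_seq big1 ?addr0// => nu.
  rewrite mem_rem_uniq ?fset_uniq// inE => /andP[/negbTE -> _].
  by rewrite mulr0.
by rewrite !D// enormN; field.
Qed.

Lemma trig_lap_dual l phi (sigma : R) : smooth_torus phi -> 0 < sigma <= 2 ->
  torus_mean (fun x => trig l x * fraclap_smooth sigma phi x) =
  torus_mean (fun x => trig_lap sigma l x * phi x).
Proof.
move=> sp s02; apply/eqP; rewrite -subr_eq0 -normr_le0; apply/ler_addgt0Pr => e e0.
rewrite add0r.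
have cp := smooth_ctorus sp.
have cl := @ctorus_trig R n l.
have [M M0 HM] := ctorus_bounded cl.
have d0 : 0 < e / (M + 1) by rewrite divr_gt0// ltr_wpDl.
have [J0 HJ0] := fraclap_smooth_approx sp s02 d0.
pose J1 := [fset p.1.2 | p in l]%fset.
pose J2 := [fset - p.1.2 | p in l]%fset.
(* J0 makes the remainder of the series small; J1 and J2 supply the frequencies of l and their
   opposites. *)
pose J := (J0 `|` (J1 `|` J2))%fset.
rewrite -(@trig_partial_dual l phi sigma J) => [|//|p pl]; last first.
  by split; rewrite !in_fsetU; [rewrite (_ : _ \in J1)|rewrite (_ : _ \in J2)];
    rewrite ?orbT//; apply/imfsetP; exists p.
have cS : ctorus (fun x => \sum_(nu <- J) fraclap_term sigma phi x nu).
  by apply: ctorus_sum => nu _; exact: ctorus_fraclap_term.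
have cF := ctorus_fraclap_smooth sp s02.
rewrite -torus_meanB; [|exact: ctorusM|exact: ctorusM].
apply: norm_torus_mean_le; first by apply: ctorusB; exact: ctorusM.
move=> x; rewrite -mulrBr normrM.
apply: (@le_trans _ _ (M * (e / (M + 1)))).
  by rewrite ler_pM// HJ0// fsubsetUl.
by rewrite mulrCA ler_piMr ?(ltW e0)// ler_pdivrMr ?ltr_wpDl// mul1r lerDl.
Qed.

End fractional_laplacian_smooth.

(** * Hoelder functions *)

Section hoelder.
Context {R : realType} {n : nat}.
Hypothesis n_gt0 : (0 < n)%N.
Implicit Types (f g phi : 'rV[R]_n -> R) (x y z v : 'rV[R]_n) (nu : 'rV[int]_n).
Implicit Types (l : seq (R * 'rV[int]_n * R)).

Lemma geodesic_dist_le x y : 0 <= geodesic_dist x y <= enorm (x - y).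
Proof.
have lb : lbound [set enorm (x - y + (2 * pi) *: intvec nu) | nu in [set: 'rV[int]_n]] 0.
  by move=> _ [nu _ <-]; exact: sqrtr_ge0.
have E : [set enorm (x - y + (2 * pi) *: intvec nu) | nu in [set: 'rV[int]_n]]
    (enorm (x - y)).
  by exists 0 => //; rewrite intvec0 scaler0 addr0.
apply/andP; split.
  by apply: lb_le_inf => //; exists (enorm (x - y)).
by apply: ge_inf => //; exists 0.
Qed.

(** The geodesic distance is at most the Euclidean one. The squared norm is kept because the
    paraboloids of the random walk are expressed with it. *)
Lemma holder_dotv alpha f : 0 < alpha -> holder_torus alpha f ->
  exists2 C, 0 <= C & forall x y, `|f x - f y| <= C * dotv (x - y) (x - y) `^ (alpha / 2).
Proof.
move=> a0 [_ [C HC]]; exists `|C| => // x y.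
have /andP[d0 d1] := geodesic_dist_le x y.
rewrite -enorm_powR2 mulrCA mulfV// mulr1 (le_trans (HC x y))//.
apply: (@le_trans _ _ (`|C| * geodesic_dist x y `^ alpha)).
  by rewrite ler_wpM2r ?powR_ge0// ler_norm.
by rewrite ler_wpM2l// ge0_ler_powR ?nnegrE ?sqrtr_ge0// ltW.
Qed.

Lemma holder_ctorus (g C : R) f : torus_fun f -> 0 < g -> 0 <= C ->
  (forall x y, `|f x - f y| <= C * dotv (x - y) (x - y) `^ g) -> ctorus f.
Proof.
move=> tf g0 C0 HC; split=> // x.
apply: (iffRL (@cvgrPdist_le _ _ _ (nbhs x) _ f (f x))) => e e0.
pose d := (e / (C + 1)) `^ g^-1.
have eC : 0 < e / (C + 1) by rewrite divr_gt0// ltr_wpDl.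
have d0 : 0 < d by rewrite powR_gt0.
have L : dotv (x - y) (x - y) @[y --> x] --> (0 : R).
  have -> : 0 = \sum_(i < n) (x 0 i - x 0 i) * (x 0 i - x 0 i).
    by rewrite big1// => i _; rewrite subrr mul0r.
  rewrite /dotv; under eq_cvg do under eq_bigr do rewrite !mxE.
  have cc i : (fun y : 'rV[R]_n => x 0 i - y 0 i) @ nbhs x --> x 0 i - x 0 i.
    by apply: (@cvgB _ _ _ (nbhs x)); [exact: cvg_cst|exact: coord_continuous].
  apply: (@cvg_sumr R _ (nbhs x) _ _ _
    (fun i y => (x 0 i - y 0 i) * (x 0 i - y 0 i))) => i _.
  exact: cvgM (cc i) (cc i).
near=> y.
rewrite (le_trans (HC _ _))//.
have yd : dotv (x - y) (x - y) < d.
  by near: y; exact: (cvgr_lt _ L).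
have : dotv (x - y) (x - y) `^ g <= e / (C + 1).
  rewrite (_ : e / (C + 1) = d `^ g); last first.
    by rewrite /d -powRrM mulVf ?gt_eqF// powRr1// ltW.
  by rewrite ge0_ler_powR ?nnegrE ?dotv_ge0 ?(ltW g0) ?(ltW d0) ?(ltW yd).
move=> H; apply: (le_trans (ler_wpM2l C0 H)).
by rewrite mulrCA ler_piMr ?(ltW e0)// ler_pdivrMr ?ltr_wpDl// mul1r lerDl.
Unshelve. all: by end_near. Qed.

(** [trig_lap] acts on lists, so a single list must represent both differences. *)
Lemma trig_lap_sub (sigma : R) l1 l2 : exists l, forall x,
  trig l x = trig l1 x - trig l2 x /\
  trig_lap sigma l x = trig_lap sigma l1 x - trig_lap sigma l2 x :> R.
Proof.
exists (l1 ++ [seq (- p.1.1, p.1.2, p.2) | p : R * 'rV[int]_n * R <- l2]) => x.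
rewrite trig_cat trig_lap_cat; split; congr (_ + _);
  rewrite /trig /trig_lap big_map -sumrN; apply: eq_bigr => p _ /=;
  by rewrite !mulNr.
Qed.

Variables (alpha C : R) (f : 'rV[R]_n -> R).
Hypotheses (alpha01 : 0 < alpha <= 1) (C_ge0 : 0 <= C) (tf : torus_fun f).
Hypothesis fC : forall x y, `|f x - f y| <= C * dotv (x - y) (x - y) `^ (alpha / 2).

Let a0 : 0 < alpha. Proof. by case/andP: alpha01. Qed.
Let cf : ctorus f.
Proof. by apply: (holder_ctorus tf _ C_ge0 fC); rewrite divr_gt0. Qed.

Definition fejer_trig N := projT1 (cid (is_trig_fejer_mean N cf)).

Lemma fejer_trigE N x : trig (fejer_trig N) x = fejer_mean N f x.
Proof. by rewrite /fejer_trig; case: (cid _) => l /= ->. Qed.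

Lemma fejer_trig_holder N x y :
  `|trig (fejer_trig N) x - trig (fejer_trig N) y| <=
  C * dotv (x - y) (x - y) `^ (alpha / 2).
Proof.
rewrite !fejer_trigE; apply: fejer_mean_dist => // z.
by rewrite (le_trans (fC _ _))// opprB addrA subrK.
Qed.

(* The difference of two approximations is Hoelder of exponent [alpha] with
   constant [2 * C] and uniformly small, hence small in the Hoelder norm of
   exponent [alpha / 2]. *)
Lemma trig_lap_fejer_dist (sigma t : R) N M : 0 < sigma -> sigma <= alpha / 4 ->
  0 <= t <= 1 ->
  (forall x, `|trig (fejer_trig N) x - f x| <= t ^+ 2) ->
  (forall x, `|trig (fejer_trig M) x - f x| <= t ^+ 2) ->
  forall x, `|trig_lap sigma (fejer_trig N) x - trig_lap sigma (fejer_trig M) x| <=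
    t * (2 * n%:R * (4 * Num.sqrt (2 * C) + 4)).
Proof.
move=> s0 sa /andP[t0 t1] HN HM x.
have /andP[_ a1] := alpha01.
have [l Hl] := trig_lap_sub sigma (fejer_trig N) (fejer_trig M).
have HB y : `|trig l y| <= 2 * t ^+ 2.
  have [-> _] := Hl y.
  have -> : trig (fejer_trig N) y - trig (fejer_trig M) y =
    (trig (fejer_trig N) y - f y) - (trig (fejer_trig M) y - f y) by ring.
  by rewrite (le_trans (ler_normB _ _))// mulr_natl mulr2n lerD.
have HC y z : `|trig l y - trig l z| <=
    2 * t * Num.sqrt (2 * C) * dotv (y - z) (y - z) `^ (alpha / 4).
  set r := dotv _ _.
  have r0 : 0 <= r by exact: dotv_ge0.
  set X := `|_|.
  have X1 : X <= 2 * C * r `^ (alpha / 2).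
    rewrite /X; have [-> _] := Hl y; have [-> _] := Hl z.
    have -> : trig (fejer_trig N) y - trig (fejer_trig M) y -
        (trig (fejer_trig N) z - trig (fejer_trig M) z) =
      (trig (fejer_trig N) y - trig (fejer_trig N) z) -
      (trig (fejer_trig M) y - trig (fejer_trig M) z) by ring.
    rewrite (le_trans (ler_normB _ _))// -mulrA mulr_natl mulr2n.
    by rewrite lerD// fejer_trig_holder.
  have X2 : X <= 4 * t ^+ 2.
    rewrite (le_trans (ler_normB _ _))// (le_trans (lerD (HB y) (HB z)))//.
    by lra.
  (* X is at most the geometric mean of its two bounds: this halves the Hoelder exponent and gains a
     factor t. *)
  have -> : 2 * t * Num.sqrt (2 * C) * r `^ (alpha / 4) =
      Num.sqrt (4 * t ^+ 2 * (2 * C * r `^ (alpha / 2))).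
    rewrite (@sqrtrM _ (4 * t ^+ 2)) ?mulr_ge0 ?sqr_ge0// (@sqrtrM _ 4)//.
    rewrite (@sqrtrM _ (2 * C)) ?mulr_ge0//.
    have -> : Num.sqrt 4 = 2 :> R.
      by rewrite (_ : 4 = 2 ^+ 2) ?sqrtr_sqr ?ger0_norm//; ring.
    rewrite sqrtr_sqr (ger0_norm t0) -(powR12_sqrt (powR_ge0 r _)) -powRrM.
    rewrite (_ : alpha / 2 / 2 = alpha / 4); last by field.
    by ring.
  have X0 : 0 <= X by exact: normr_ge0.
  by rewrite -[X]ger0_norm// -sqrtr_sqr ler_wsqrtr// expr2 ler_pM.
have sE : sigma = 2 * (sigma / 2) by field.
(* With s = sigma/2 and g = alpha/4, the condition 2 s <= g is the hypothesis on sigma. *)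
have := @trig_lap_bound R n n_gt0 (sigma / 2) (alpha / 4) (2 * t ^+ 2)
  (2 * t * Num.sqrt (2 * C)) l.
rewrite -sE !mulr_ge0 ?sqrtr_ge0 ?sqr_ge0 ?divr_gt0//.
move=> /(_ isT sa) H.
have [_ <-] := Hl x.
apply: (le_trans (H _ isT isT HB HC x)); first by lra.
have n1 : 1 <= 2 * n%:R :> R.
  by rewrite -natrM ler1n muln_gt0.
(* Since 2 n >= 1 and sigma/2 <= 1, replacing (2 n)^(sigma/2) by 2 n removes sigma from the
   constant. *)
apply: (@le_trans _ _ (2 * n%:R * (2 * (2 * t * Num.sqrt (2 * C)) + 2 * (2 * t ^+ 2)))).
  rewrite ler_wpM2r//.
    by rewrite addr_ge0 ?mulr_ge0 ?sqrtr_ge0 ?sqr_ge0.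
  by rewrite ler1_powR//; lra.
rewrite [leRHS]mulrCA ler_wpM2l ?mulr_ge0//.
have : t ^+ 2 <= t by rewrite expr2 ler_piMr.
by move=> t2; move: (Num.sqrt _) => q; lra.
Qed.

Lemma trig_lap_fejer_cauchy (e : R) : 0 < e ->
  \forall N \near \oo, (forall x, `|trig (fejer_trig N) x - f x| <= e) /\
   forall M, (N <= M)%N -> forall sigma, 0 < sigma <= alpha / 4 -> forall x,
   `|trig_lap sigma (fejer_trig N) x - trig_lap sigma (fejer_trig M) x| <= e.
Proof.
move=> e0.
pose D := 2 * n%:R * (4 * Num.sqrt (2 * C) + 4).
have D0 : 0 <= D by rewrite !mulr_ge0// addr_ge0// mulr_ge0// sqrtr_ge0.
(* t <= 1 is the range of [trig_lap_fejer_dist], and with t <= e it yields t^2 <= e; the last term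
   gives t D <= e. *)
pose t := Num.min 1 (Num.min e (e / (D + 1))).
have eD : 0 < e / (D + 1) by rewrite divr_gt0// ltr_wpDl.
have t0 : 0 < t by rewrite !lt_min ltr01 e0 eD.
have t1 : t <= 1 by rewrite ge_min lexx.
have te : t <= e by rewrite !ge_min lexx orbT.
have tD : t * D <= e.
  have : t <= e / (D + 1) by rewrite !ge_min lexx !orbT.
  rewrite ler_pdivlMr ?ltr_wpDl//; apply: le_trans.
  by rewrite ler_wpM2l ?lerDl// ltW.
have t2 : 0 < t ^+ 2 by rewrite exprn_gt0.
have [N0 _ HN0] := fejer_mean_unif cf t2.
exists N0 => // N /= N0N; split=> [x|M NM sigma /andP[s0 s1] x].
  rewrite fejer_trigE (le_trans (HN0 N N0N x))// (le_trans _ te)//.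
  by rewrite expr2 ler_piMr// ltW.
apply: (le_trans _ tD); apply: trig_lap_fejer_dist => //.
- by rewrite t1 ltW.
- by move=> y; rewrite fejer_trigE; exact: HN0.
- by move=> y; rewrite fejer_trigE; apply: HN0; rewrite /= (leq_trans N0N).
Qed.

Definition fraclap_lim (sigma : R) x : R :=
  limn (fun N => trig_lap sigma (fejer_trig N) x).

Lemma cvg_fraclap_lim (sigma : R) x : 0 < sigma <= alpha / 4 ->
  trig_lap sigma (fejer_trig N) x @[N --> \oo] --> fraclap_lim sigma x.
Proof.
move=> sa.
suff : cvg (trig_lap sigma (fejer_trig N) x @[N --> \oo]) by [].
apply: cauchy_cvg.
suff : cauchy_ex (trig_lap sigma (fejer_trig N) x @[N --> \oo]) by exact: cauchy_exP.
move=> e /= e0.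
have [N _ /(_ N (leqnn N))[_ HN]] := trig_lap_fejer_cauchy (divr_gt0 e0 (ltr0n R 2)).
exists (trig_lap sigma (fejer_trig N) x); exists N => // M /= NM.
rewrite /ball/= (le_lt_trans (HN _ NM _ sa x))//.
by rewrite ltr_pdivrMr// ltr_pMr// ltr1n.
Qed.

Lemma fraclap_lim_dist (e : R) : 0 < e ->
  \forall N \near \oo, (forall x, `|trig (fejer_trig N) x - f x| <= e) /\
   forall sigma, 0 < sigma <= alpha / 4 -> forall x,
   `|fraclap_lim sigma x - trig_lap sigma (fejer_trig N) x| <= e.
Proof.
move=> /trig_lap_fejer_cauchy; apply: filterS => N [H1 H2].
split=> // sigma sa x; rewrite distrC.
have L : `|trig_lap sigma (fejer_trig N) x - trig_lap sigma (fejer_trig M) x|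
    @[M --> \oo] --> `|trig_lap sigma (fejer_trig N) x - fraclap_lim sigma x|.
  by apply: cvg_norm; apply: cvgB; [exact: cvg_cst|exact: cvg_fraclap_lim].
rewrite -(cvg_lim _ L)//; apply: limr_le; first by apply/cvg_ex; eexists; exact: L.
by exists N => // M /= NM; exact: H2.
Qed.

Lemma ctorus_fraclap_lim (sigma : R) : 0 < sigma <= alpha / 4 ->
  ctorus (fraclap_lim sigma).
Proof.
move=> sa; apply: ctorus_unif => e e0.
have [N _ /(_ N (leqnn N))[_ HN]] := fraclap_lim_dist e0.
exists (trig_lap sigma (fejer_trig N)); first exact: ctorus_trig_lap.
exact: HN.
Qed.

(** The identity holds for the Fejer polynomials by [trig_lap_dual]. Both sides pass to the limit
    because f and [fraclap_lim] are approximated uniformly and are paired with bounded functions. *)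
Lemma fraclap_lim_dual (sigma : R) phi : 0 < sigma <= alpha / 4 -> smooth_torus phi ->
  torus_mean (fun x => f x * fraclap_smooth sigma phi x) =
  torus_mean (fun x => fraclap_lim sigma x * phi x).
Proof.
move=> sa sp.
have s02 : 0 < sigma <= 2.
  by have /andP[s0 s1] := sa; have /andP[_ a1] := alpha01; apply/andP; split => //; lra.
have cp := smooth_ctorus sp; have cS := ctorus_fraclap_smooth n_gt0 sp s02.
have cg := ctorus_fraclap_lim sa.
have [M1 M10 HM1] := ctorus_bounded cS; have [M2 M20 HM2] := ctorus_bounded cp.
apply/eqP; rewrite -subr_eq0 -normr_le0; apply/ler_addgt0Pr => e e0; rewrite add0r.
pose d := e / (M1 + M2 + 1).
have M0 : 0 < M1 + M2 + 1 by rewrite ltr_wpDl// addr_ge0.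
have d0 : 0 < d by rewrite divr_gt0.
have [N _ /(_ N (leqnn N))[H1 H2]] := fraclap_lim_dist d0.
have cl := @ctorus_trig R n (fejer_trig N).
have cL := @ctorus_trig_lap R n sigma (fejer_trig N).
have -> : torus_mean (fun x => f x * fraclap_smooth sigma phi x) -
    torus_mean (fun x => fraclap_lim sigma x * phi x) =
    torus_mean (fun x => (f x - trig (fejer_trig N) x) * fraclap_smooth sigma phi x) +
    torus_mean (fun x => (trig_lap sigma (fejer_trig N) x - fraclap_lim sigma x) * phi x).
  under [in RHS]eq_torus_mean do rewrite mulrBl.
  under [X in _ = _ + X]eq_torus_mean do rewrite mulrBl.
  rewrite !torus_meanB; [|exact: ctorusM|exact: ctorusM|exact: ctorusM|exact: ctorusM].
  by rewrite trig_lap_dual//; ring.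
apply: (@le_trans _ _ (d * M1 + d * M2)).
  rewrite (le_trans (ler_normD _ _))// lerD//; apply: norm_torus_mean_le.
  - by apply: ctorusM => //; exact: ctorusB.
  - by move=> x; rewrite normrM ler_pM// distrC.
  - by apply: ctorusM => //; exact: ctorusB.
  - by move=> x; rewrite normrM ler_pM// distrC; exact: H2.
rewrite -mulrDr /d mulrAC ler_pdivrMr// ler_wpM2l ?ltW//.
by rewrite ltrDl.
Qed.

(** The limit witnesses that [get] has something to choose; [ctorus_eq] then identifies the chosen
    function with it. *)
Lemma fraclap_limE (sigma : R) : 0 < sigma <= alpha / 4 ->
  fraclap sigma f =1 fraclap_lim sigma.
Proof.
move=> sa; have cg := ctorus_fraclap_lim sa.
have [|tg ctg Hg] := @getPex _ (distr_is_continuous_fun (fraclap_distr sigma f)).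
  exists (fraclap_lim sigma); split; [exact: cg.1|exact: cg.2|].
  by move=> phi sp; rewrite /fraclap_distr !torus_integral_mean fraclap_lim_dual.
apply: ctorus_eq => // phi sp.
rewrite -fraclap_lim_dual// /torus_mean; congr (_ * _).
exact/esym/Hg.
Qed.

Lemma cvg_trig_lap l x :
  trig_lap sigma l x @[sigma --> 0^'+] --> trig l x - torus_mean (trig l).
Proof.
rewrite torus_mean_trig /trig -sumrB; apply: (@cvg_sumr R) => p _.
have [p0|p0] := eqVneq p.1.2 0.
  rewrite p0 mul1r /wave intvec0 dotv0l add0r subrr.
  have e0 : enorm (0 : 'rV[R]_n) = 0 by rewrite /enorm dotv0l sqrtr0.
  apply: (@cvg_trans _ ((fun=> 0) @ (0 : R)^'+)); last exact: cvg_cst.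
  (* Here sigma is nonzero, which matters: [powR] sends (0, 0) to 1, and it is the value 0 for sigma
     > 0 that removes the mean. *)
  apply: near_eq_cvg; near=> sigma.
  by rewrite e0 powR0 ?mulr0 ?mul0r//.
rewrite mul0r mulr0 subr0; apply: cvgM; last exact: cvg_cst.
rewrite -[X in _ --> X]mulr1; apply: cvgM; first exact: cvg_cst.
have e0 : 0 < enorm (intvec p.1.2) :> R.
  rewrite sqrtr_gt0 lt0r dotv_ge0 andbT; apply: contra_neq p0 => d0.
  apply/rowP => i; rewrite mxE; move/eqP: d0; rewrite psumr_eq0 => [|j _]; last first.
    by rewrite -expr2 sqr_ge0.
  move=> /allP/(_ i); rewrite mem_index_enum => /(_ isT).
  by rewrite mulf_eq0 orbb mxE intr_eq0 => /eqP.
have L : expR (s * ln (enorm (intvec p.1.2))) @[s --> (0 : R)] --> (1 : R).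
  have L0 : s * ln (enorm (intvec p.1.2)) @[s --> (0 : R)] --> (0 : R).
    rewrite -[X in _ --> X](mul0r (ln (enorm (intvec p.1.2)))).
    by apply: cvgM; [exact: cvg_id|exact: cvg_cst].
  by have := continuous_cvg _ (@continuous_expR R 0) L0; rewrite expR0; apply.
apply: cvg_trans (cvg_at_right_filter L); apply: near_eq_cvg.
by near=> s; rewrite /powR gt_eqF.
Unshelve. all: by end_near. Qed.

Lemma cvg_fraclap_holder x :
  fraclap sigma f x @[sigma --> 0^'+] --> f x - torus_mean f.
Proof.
apply/cvgrPdist_le => e e0.
(* Four errors are added: [fraclap] against [trig_lap], [trig_lap] against its limit, the polynomial
   against f at x, and the two means. *)
have e4 : 0 < e / 4 by rewrite divr_gt0.
have [N _ /(_ N (leqnn N))[H1 H2]] := fraclap_lim_dist e4.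
have := @cvg_trig_lap (fejer_trig N) x; move=> /cvgrPdist_le/(_ _ e4) H3.
near=> sigma.
have sa : 0 < sigma <= alpha / 4.
  apply/andP; split; first by near: sigma; exact: nbhs_right_gt.
  by near: sigma; apply: nbhs_right_le; rewrite divr_gt0.
have H4 : `|trig (fejer_trig N) x - torus_mean (trig (fejer_trig N)) -
    trig_lap sigma (fejer_trig N) x| <= e / 4.
  by near: sigma; exact: H3.
rewrite fraclap_limE//.
have cl := @ctorus_trig R n (fejer_trig N).
have M : `|torus_mean (trig (fejer_trig N)) - torus_mean f| <= e / 4.
  by rewrite -torus_meanB//; apply: norm_torus_mean_le => //; exact: ctorusB.
have := H1 x; have := H2 _ sa x; move: H4 M; rewrite !ler_norml.
move=> /andP[? ?] /andP[? ?] /andP[? ?] /andP[? ?].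
by apply/andP; split; lra.
Unshelve. all: by end_near. Qed.

End hoelder.

Theorem proposition5p2 (R : realType) (n : nat) (hn : (1 <= n)%N) (alpha : R)
    (halpha : 0 < alpha <= 1) (f : 'rV[R]_n -> R) (hf : holder_torus alpha f) :
  forall x : 'rV[R]_n,
    fraclap sigma f x @[sigma --> 0^'+] -->
      f x - ((2 * pi) ^+ n)^-1 * torus_integral f.
Proof.
move=> x; have a0 : 0 < alpha by case/andP: halpha.
have [C C0 HC] := holder_dotv a0 hf.
exact: (cvg_fraclap_holder hn halpha C0 hf.1 HC).
Qed.
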